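(* Let $\rho_{0,h}\in Q_h$, $m_{0,h}\in V_h$ and assume that $\rho_{0,h}\ge\underline\rho$ for some constant $\underline\rho>0$. Then there exists $T>0$ such that the semi-discrete problem (S) defined in the context has a unique solution $(\rho_h,m_h)\in C^1([0,T);Q_h\times V_h)$, and $\rho_h(t)>0$ for all $0\le t<T$. If $a\ge\underline a$ for some constant $\underline a>0$ (i.e. $a_e\ge\underline a$ for all $e\in\mathcal E$), then one can choose $T=\infty$, i.e., the solution is global.
   Context: Network. $\mathcal G=(\mathcal V,\mathcal E,\ell)$ is a finite, directed, connected graph with vertex set $\mathcal V$, edge set $\mathcal E\subset\mathcal V\times\mathcal V$, and lengths $\ell_e>0$, $e\in\mathcal E$. An edge $e=(v_1,v_2)$ is identified with the interval $[0,\ell_e]$ ($v_1$ corresponding to $0$, $v_2$ to $\ell_e$), and $n_e(v_1)=-1$, $n_e(v_2)=1$. $\mathcal E(v)$ is the set of edges incident on $v$. For a function $u$ on the network, $u_e=u|_e$, and $u_e(v)$ is its value at the endpoint $v$. $L^2(\mathcal E)$ and $H^1(\mathcal E)$ are the spaces of functions with $u_e\in L^2(e)$, resp. $H^1(e)$, for every $e$ (no continuity at vertices); $(u,v)_{\mathcal E}=\sum_{e}\int_0^{\ell_e}u_ev_e\,dx$; $(\partial_x'u)|_e=\partial_x(u_e)$. $H_0(\mathrm{div})=\{m\in H^1(\mathcal E):\sum_{e\in\mathcal E(v)}m_e(v)n_e(v)=0\ \forall v\in\mathcal V\}$. Data. $a_e,b_e\ge0$, $c_e>0$ are constants on each edge,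 $a,b$ the edgewise constant functions with values $a_e,b_e$; $\gamma>1$; $P_e(\rho)=\frac{c_e}{\gamma-1}\rho^\gamma$; $P'(\rho)$ has restriction $P_e'(\rho_e)$ to $e$. Finite element spaces. $T_h(e)$ is a uniform mesh of $[0,\ell_e]$ into finitely many subintervals $K$, and $T_h(\mathcal E)$ is the collection of these meshes. $P_k(T_h(\mathcal E))$ is the space of functions in $L^2(\mathcal E)$ that are polynomials of degree $\le k$ on every element $K$. $V_h=P_1(T_h(\mathcal E))\cap H_0(\mathrm{div})$ and $Q_h=P_0(T_h(\mathcal E))$. Semi-discrete problem (S) on $[0,T)$: find $(\rho_h,m_h)\in C^1([0,T);Q_h\times V_h)$ with $\rho_h(0)=\rho_{0,h}$, $m_h(0)=m_{0,h}$, such that for all $q_h\in Q_h$, $v_h\in V_h$ and every $t\in[0,T)$ \begin{align*} (\partial_t\rho_h,q_h)_{\mathcal E}&=-(\partial_x'm_h,q_h)_{\mathcal E},\\ \Big(\tfrac1{\rho_h}\partial_tm_h-\tfrac{m_h}{2\rho_h^2}\partial_t\rho_h,v_h\Big)_{\mathcal E}&=\Big(\tfrac{m_h^2}{2\rho_h^2}+P'(\rho_h)-\tfrac{a}{\rho_h^2}\partial_x'm_h,\partial_x'v_h\Big)_{\mathcal E}-\Big(\tfrac{m_h}{2\rho_h^2}\partial_x'm_h+b\tfrac{|m_h|m_h}{\rho_h^2},v_h\Big)_{\mathcal E}. \end{align*} The equations are understood to require $\rho_h$ to be positive so that all terms are defined. *)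

(* Defs.v *)
From HB Require Import structures.
From mathcomp Require Import all_boot all_order all_algebra.
From mathcomp Require Import all_classical all_reals all_analysis.

Set Implicit Arguments.
Unset Strict Implicit.
Unset Printing Implicit Defensive.

Import Order.TTheory GRing.Theory Num.Theory.
Import numFieldNormedType.Exports.

Local Open Scope classical_set_scope.
Local Open Scope ring_scope.

(* Connectedness is that of the underlying undirected graph. *)
Record network (R : realType) := Network {
  vertex : finType;
  edges : {set vertex * vertex};
  len : {e : vertex * vertex | e \in edges} -> R;
  len_gt0 : forall e, 0 < len e;
  network_connected : forall v w : vertex,
    connect (fun x y => ((x, y) \in edges) || ((y, x) \in edges)) v w
}.

Definition edge (R : realType) (G : network R) : finType :=
  {e : vertex G * vertex G | e \in edges G}.

Definition tail (R : realType) (G : network R) (e : edge G) : vertex G :=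
  (val e).1.
Definition head (R : realType) (G : network R) (e : edge G) : vertex G :=
  (val e).2.

(* [u e x] is the value of the restriction u_e at x; only x in [0, len e] is
   relevant. *)
Definition netfun (R : realType) (G : network R) := edge G -> R -> R.

Definition inner (R : realType) (G : network R) (u v : netfun G) : R :=
  \sum_(e : edge G)
    Rintegral (@lebesgue_measure R) `[0, len e] (fun x => u e x * v e x).

(* Classical derivative on each edge. On a piecewise polynomial function that
   is continuous on the edges it is defined off the mesh points, and there it
   coincides with the weak derivative. *)
Definition dx (R : realType) (G : network R) (u : netfun G) : netfun G :=
  fun e => derive1 (u e).

Definition L2 (R : realType) (l : R) (u : R -> R) : Prop :=
  measurable_fun `[0, l] u /\
  (@lebesgue_measure R).-integrable `[0, l] (fun x => (u x ^+ 2)%:E).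

(* C_c^oo(0, l) *)
Definition test_function (R : realType) (l : R) (phi : R -> R) : Prop :=
  (forall (k : nat) (x : R), derivable (derive1n k phi) x 1) /\
  (exists x1 x2 : R, [/\ 0 < x1, x2 < l &
     forall x, ~ (x1 <= x <= x2) -> phi x = 0]).

Definition weak_derivative (R : realType) (l : R) (u g : R -> R) : Prop :=
  forall phi, test_function l phi ->
    Rintegral (@lebesgue_measure R) `[0, l] (fun x => u x * derive1 phi x) =
    - Rintegral (@lebesgue_measure R) `[0, l] (fun x => g x * phi x).

(* H^1(0, l), each class being represented by its unique continuous member on
   [0, l], so that the values at the endpoints are the traces. *)
Definition H1 (R : realType) (l : R) (u : R -> R) : Prop :=
  [/\ {within `[0, l], continuous u}, L2 l u &
      exists2 g : R -> R, L2 l g & weak_derivative l u g].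

(* The sum over the edges incident on v of m_e(v) n_e(v): n_e is 1 at the head
   of e, where x = len e, and -1 at its tail, where x = 0. A loop contributes
   through both of its ends. *)
Definition vertex_flux (R : realType) (G : network R) (u : netfun G)
    (v : vertex G) : R :=
  \sum_(e : edge G | head e == v) u e (len e) -
  \sum_(e : edge G | tail e == v) u e 0.

Definition H0div (R : realType) (G : network R) (u : netfun G) : Prop :=
  (forall e : edge G, H1 (len e) (u e)) /\
  (forall v : vertex G, vertex_flux u v = 0).

(* Uniform meshes: the edge e is divided into [N e] subintervals, and an element
   is a pair of an edge and of the position of a subinterval on it. *)
Definition element (R : realType) (G : network R) (N : edge G -> nat) :
  finType := {e : edge G & 'I_(N e)}.

Definition mesh_point (R : realType) (G : network R) (N : edge G -> nat)
    (e : edge G) (i : nat) : R := i%:R * (len e / (N e)%:R).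

(* The elements are taken half-open, except for the last one of each edge, which
   is closed, so that they partition [0, len e]. *)
Definition in_element (R : realType) (G : network R) (N : edge G -> nat)
    (e : edge G) (i : 'I_(N e)) (x : R) : bool :=
  (mesh_point N e i <= x) &&
  (x < mesh_point N e i.+1 ?<= if (i.+1 == N e)).

(* P_k(T_h(E)). The row of u with index [enum_rank K] consists of the
   coefficients, in powers of the coordinate x of the edge, of the polynomial
   which u is equal to on K. *)
Definition fe_space (R : realType) (G : network R) (N : edge G -> nat)
  (k : nat) := 'M[R]_(#|{: element N}|, k.+1).

Definition fe_poly (R : realType) (G : network R) (N : edge G -> nat)
    (k : nat) (u : fe_space N k) (K : element N) : {poly R} :=
  rVpoly (row (enum_rank K) u).

Definition fe_fun (R : realType) (G : network R) (N : edge G -> nat)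
    (k : nat) (u : fe_space N k) : netfun G :=
  fun e x => \sum_(i < N e | in_element i x)
    (fe_poly u (Tagged (fun e => 'I_(N e)) i)).[x].

Definition Qh (R : realType) (G : network R) (N : edge G -> nat) :=
  fe_space N 0.

Definition Vh (R : realType) (G : network R) (N : edge G -> nat) :
    set (fe_space N 1) :=
  [set m | H0div (fe_fun m)].

(* The time interval [0, T), where T may be +oo. *)
Definition time_interval (R : realType) (T : \bar R) : set R :=
  [set t | 0 <= t /\ (t%:E < T)%E].

(* f is C^1 on D with derivative f'; difference quotients are taken within D,
   hence are one-sided at an endpoint of D. *)
Definition C1_on (R : realType) (X : normedModType R) (D : set R)
    (f f' : R -> X) : Prop :=
  (forall t, D t ->
     (fun s => (s - t)^-1 *: (f s - f t)) @ within D t^' --> f' t) /\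
  {within D, continuous f'}.

Definition potential (R : realType) (G : network R) (c : edge G -> R)
    (gamma : R) (e : edge G) (r : R) : R :=
  c e / (gamma - 1) * r `^ gamma.

Definition dpotential (R : realType) (G : network R) (c : edge G -> R)
    (gamma : R) (e : edge G) : R -> R :=
  derive1 (potential c gamma e).

Definition pos_density (R : realType) (G : network R) (N : edge G -> nat)
    (rho : Qh N) : Prop :=
  forall (e : edge G) (x : R), 0 <= x <= len e -> 0 < fe_fun rho e x.

(* The two variational equations at a fixed time, with [rho'] and [m'] the time
   derivatives. *)
Definition mass_equation (R : realType) (G : network R) (N : edge G -> nat)
    (m : fe_space N 1) (rho' : Qh N) : Prop :=
  forall q : Qh N,
    inner (fe_fun rho') (fe_fun q) = - inner (dx (fe_fun m)) (fe_fun q).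

Definition momentum_equation (R : realType) (G : network R)
    (a b c : edge G -> R) (gamma : R) (N : edge G -> nat)
    (rho : Qh N) (m : fe_space N 1) (rho' : Qh N) (m' : fe_space N 1) : Prop :=
  let r := fe_fun rho in let mu := fe_fun m in
  forall v : fe_space N 1, Vh v ->
    inner (fun e x => (r e x)^-1 * fe_fun m' e x
                      - mu e x / (2 * r e x ^+ 2) * fe_fun rho' e x)
          (fe_fun v) =
    inner (fun e x => mu e x ^+ 2 / (2 * r e x ^+ 2)
                      + dpotential c gamma e (r e x)
                      - a e / r e x ^+ 2 * dx mu e x)
          (dx (fe_fun v))
    - inner (fun e x => mu e x / (2 * r e x ^+ 2) * dx mu e x
                        + b e * (`|mu e x| * mu e x / r e x ^+ 2))
            (fe_fun v).

(* Positivity of the density is part of the notion of solution: otherwise the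
   terms of the momentum equation are not defined. *)
Definition solution (R : realType) (G : network R)
    (a b c : edge G -> R) (gamma : R) (N : edge G -> nat)
    (rho0 : Qh N) (m0 : fe_space N 1) (T : \bar R)
    (rho : R -> Qh N) (m : R -> fe_space N 1) : Prop :=
  [/\ forall t, time_interval T t -> Vh (m t) /\ pos_density (rho t),
      rho 0 = rho0, m 0 = m0 &
      exists (rho' : R -> Qh N) (m' : R -> fe_space N 1),
        [/\ C1_on (time_interval T) rho rho', C1_on (time_interval T) m m' &
            forall t, time_interval T t ->
              mass_equation (m t) (rho' t) /\
              momentum_equation a b c gamma (rho t) (m t) (rho' t) (m' t)]].

(* Solutions are functions on [0, T), hence are only compared there. *)
Definition uniquely_solvable (R : realType) (G : network R)
    (a b c : edge G -> R) (gamma : R) (N : edge G -> nat)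
    (rho0 : Qh N) (m0 : fe_space N 1) (T : \bar R) : Prop :=
  exists (rho : R -> Qh N) (m : R -> fe_space N 1),
    [/\ solution a b c gamma rho0 m0 T rho m,
        forall t, time_interval T t -> pos_density (rho t) &
        forall (rho2 : R -> Qh N) (m2 : R -> fe_space N 1),
          solution a b c gamma rho0 m0 T rho2 m2 ->
          forall t, time_interval T t -> rho2 t = rho t /\ m2 t = m t].

(* Main.v *)
(* Testing with a basis of V_h turns (S) into an ordinary differential equation
   for the element values of rho and the coordinates of m: the mass equation
   reads rho' = - dx m elementwise, and the mass matrix weighted by 1 / rho is
   positive definite while rho > 0. Its right-hand side is Lipschitz on boxes on
   which rho is bounded away from 0, which gives local existence and uniqueness
   by Picard iteration and Gronwall's inequality.

   For global existence, test the momentum equation with m: the energy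
   E = (m^2 / (2 rho) + P(rho), 1) satisfies E' <= - (a (dx m / rho)^2, 1). On an
   element K of length h, (ln rho)' = - dx m / rho =: w, so E' <= - amin h w^2,
   and |w| <= (1 + w^2) / 2 shows that t / 2 - E / (2 amin h) + ln rho and
   t / 2 - E / (2 amin h) - ln rho are nondecreasing. Hence rho stays between
   positive bounds on bounded time intervals, and then E <= E(0) bounds m. *)

Require Import Defs.
From mathcomp Require Import all_boot all_order all_algebra.
From mathcomp Require Import all_classical all_reals all_analysis.
From mathcomp Require Import measurable_realfun ring lra.

Set Implicit Arguments.
Unset Strict Implicit.
Unset Printing Implicit Defensive.

Import Order.TTheory GRing.Theory Num.Theory.
Import numFieldNormedType.Exports.

Local Open Scope classical_set_scope.
Local Open Scope ring_scope.

(** * Calculus on the half-line *)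

(** The right-hand side makes sense only while rho > 0, and no maximal solution is constructed.
    Instead the state is clipped to a box of positive densities; the clipped equation has a solution
    for all times, which solves (S) as long as it stays in the box. For small T continuity keeps it
    there. For global existence the box is chosen with a margin around a priori bounds that depend
    only on the data and the final time: a solution that has been in the closed box up to time t is
    then in its interior, so it cannot leave.

    The energy inequality rests on exact cancellations. For v = m the left-hand side is the time
    derivative of (m^2 / (2 rho), 1), the convective terms m^2 dx m / (2 rho^2) cancel, and
    (P'(rho), dx m) is minus the time derivative of (P(rho), 1), because rho' = - dx m holds
    pointwise inside the elements. The viscous term and the friction - (b |m| m^2 / rho^2, 1) <= 0
    remain.

    A competing solution has only a one-sided derivative at 0, so uniqueness relies on derivatives
    at positive times and on continuity. *)

Section Calculus.
Variable R : realType.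
Implicit Types (f df F : R -> R).

Lemma le_of_derive_ge0 f df (a b : R) : a <= b ->
  (forall x : R, a < x < b -> is_derive x 1 f (df x)) ->
  (forall x : R, a < x < b -> 0 <= df x) ->
  {within `[a, b], continuous f} -> f a <= f b.
Proof.
rewrite le_eqVlt => /predU1P[->//|ab] fd d0 fc.
have fd' x : x \in `]a, b[%R -> is_derive x 1 f (df x).
  by rewrite in_itv/=; exact: fd.
have [c] := MVT ab fd' fc.
rewrite in_itv/= => /d0 c0 e.
by rewrite -subr_ge0 e mulr_ge0// subr_ge0 ltW.
Qed.

Lemma lipschitz_continuous f (L : R) :
  (forall s t, `|f s - f t| <= L * `|s - t|) -> continuous f.
Proof.
move=> fL t; apply/cvgrPdist_lt => e e0.
near=> s.
have L0 : 0 < `|L| + 1 by rewrite ltr_wpDl.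
apply: (le_lt_trans (fL _ _)).
apply: (@le_lt_trans _ _ ((`|L| + 1) * `|t - s|)).
  by rewrite ler_wpM2r// (le_trans (ler_norm L))// lerDl.
rewrite -ltr_pdivlMl//; near: s.
apply: cvgr_dist_lt; last by rewrite mulr_gt0// invr_gt0.
exact: cvg_id.
Unshelve. all: by end_near. Qed.

(* The base point -1 makes the derivative at 0 two-sided. *)
Definition primitive f (t : R) : R :=
  Rintegral (@lebesgue_measure R) `[-1, t] f -
  Rintegral (@lebesgue_measure R) `[-1, 0] f.

Lemma primitive0 f : primitive f 0 = 0.
Proof. exact: subrr. Qed.

Lemma is_derive_primitive f (t : R) : continuous f -> -1 < t ->
  is_derive t 1 (primitive f) (f t).
Proof.
move=> fc t1.
have fi : (@lebesgue_measure R).-integrable `[-1, t + 1] (EFin \o f).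
  apply: continuous_compact_integrable; first exact: segment_compact.
  exact: continuous_subspaceT.
have tt : t < t + 1 by rewrite ltrDl.
have [d1 d2] := continuous_FTC1_closed tt fi t1 (fc t).
rewrite /primitive -[f t]subr0; apply: is_deriveB.
by split; [exact: d1|rewrite -derive1E; exact: d2].
Qed.

(** Both [g + F] and [g - F] are nondecreasing and start from a nonnegative value. This comparison
    spares the Picard estimates any manipulation of integrals. *)
Lemma le_norm_of_derive F f (g dg : R -> R) (t : R) : 0 <= t ->
  F 0 = 0 -> 0 <= g 0 ->
  (forall x : R, 0 <= x -> is_derive x 1 F (f x)) ->
  (forall x : R, 0 <= x -> is_derive x 1 g (dg x)) ->
  (forall x : R, 0 <= x -> `|f x| <= dg x) -> `|F t| <= g t.
Proof.
move=> t0 F0 g0 dF dG fg.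
have cont (h dh : R -> R) : (forall x : R, 0 <= x -> is_derive x 1 h (dh x)) ->
    {within `[0, t], continuous h}.
  move=> hd; apply: derivable_within_continuous => x.
  by rewrite in_itv/= => /andP[x0 _]; have := hd _ x0; case.
have Hn : - F t <= g t.
  have : (F + g) 0 <= (F + g) t.
    apply: (@le_of_derive_ge0 _ (fun x => f x + dg x)) => //.
    - by move=> x /andP[/ltW x0 _]; apply: is_deriveD; [exact: dF|exact: dG].
    - by move=> x /andP[/ltW x0 _]; have := fg _ x0; rewrite ler_norml; lra.
    - apply: (cont _ (fun x => f x + dg x)) => x x0.
      by apply: is_deriveD; [exact: dF|exact: dG].
  by rewrite !addrfctE F0; lra.
have Hp : F t <= g t.
  have : (g - F) 0 <= (g - F) t.
    apply: (@le_of_derive_ge0 _ (fun x => dg x - f x)) => //.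
    - by move=> x /andP[/ltW x0 _]; apply: is_deriveB; [exact: dG|exact: dF].
    - by move=> x /andP[/ltW x0 _]; have := fg _ x0; rewrite ler_norml; lra.
    - apply: (cont _ (fun x => dg x - f x)) => x x0.
      by apply: is_deriveB; [exact: dG|exact: dF].
  by rewrite !(addrfctE, opprfctE) F0; lra.
by rewrite ler_norml Hp andbT lerNl.
Qed.

Lemma le0_of_le_geometric (x c : R) :
  (forall k, x <= c * 2^-1 ^+ k) -> x <= 0.
Proof.
move=> xk.
have c0 : (c * 2^-1 ^+ k) @[k --> \oo] --> (c * 0 : R).
  by apply: cvgMr; apply: cvg_expr; rewrite ger0_norm ?invr_ge0// invf_lt1 ?ltr1n.
rewrite mulr0 in c0.
rewrite -(cvg_lim (@Rhausdorff R) c0); apply: limr_ge; last exact: nearW.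
by apply/cvg_ex; exists 0.
Qed.

(** The intervals of radius [2 * c * 2^-1 ^+ k] around [u k] are nested, the radius being the sum of
    the remaining steps. The limit is the supremum of their left ends. *)
Lemma cvg_geometric_steps (u : nat -> R) (c : R) :
  (forall k, `|u k.+1 - u k| <= c * 2^-1 ^+ k) ->
  exists l, forall k, `|u k - l| <= 2 * c * 2^-1 ^+ k.
Proof.
move=> uc.
pose v k := u k - 2 * c * 2^-1 ^+ k; pose w k := u k + 2 * c * 2^-1 ^+ k.
have h k : 2 * c * 2^-1 ^+ k.+1 = c * 2^-1 ^+ k.
  by rewrite exprS; field.
have vS : {homo v : i j / (i <= j)%N >-> i <= j}.
  apply: homo_leq; [exact: lexx|exact: le_trans|move=> k].
  by have := uc k; rewrite /v h ler_norml; lra.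
have wS : {homo w : i j / (i <= j)%N >-> j <= i}.
  apply: homo_leq; [exact: lexx|by move=> ? ? ? /[swap]; exact: le_trans|].
  by move=> k; have := uc k; rewrite /w h ler_norml; lra.
have vw i j : v i <= w j.
  apply: (le_trans (vS _ _ (leq_maxl i j))).
  apply: le_trans (wS _ _ (leq_maxr i j)).
  rewrite /v /w; have := uc (maxn i j); have :=
    normr_ge0 (u (maxn i j).+1 - u (maxn i j)).
  by lra.
exists (sup (range v)) => k.
have hs : has_sup (range v).
  split; first by exists (v 0%N), 0%N.
  by exists (w 0%N) => _ [i _ <-].
have : v k <= sup (range v) by apply: ub_le_sup; [case: hs|exists k].
have : sup (range v) <= w k.
  by apply: ge_sup; [case: hs|move=> _ [i _ <-]].
by rewrite /v /w ler_norml; lra.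
Qed.

End Calculus.

(** * Ordinary differential equations *)

Lemma is_derive_mulr (R : realType) (f g : R -> R) (a b t : R) :
  is_derive t 1 f a -> is_derive t 1 g b ->
  is_derive t 1 (fun s => f s * g s) (a * g t + f t * b).
Proof.
move=> fa gb; apply: (is_derive_eq (is_deriveM fa gb)).
by rewrite /GRing.scale/= addrC (mulrC (g t)).
Qed.

Lemma is_derive_bigsum (R : realType) (J : Type) (r : seq J)
    (f : J -> R -> R) (df : J -> R) (t : R) :
  (forall j, is_derive t 1 (f j) (df j)) ->
  is_derive t 1 (fun s => \sum_(j <- r) f j s) (\sum_(j <- r) df j).
Proof.
move=> fd; elim: r => [|j r IH].
  under eq_fun do rewrite big_nil.
  by rewrite big_nil; exact: is_derive_cst.
under eq_fun do rewrite big_cons.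
by rewrite big_cons; exact: is_deriveD.
Qed.

Lemma cvg_bigsum (R : realType) (T : Type) (F : set_system T) (FF : Filter F)
    (J : Type) (r : seq J) (f : J -> T -> R) (l : J -> R) :
  (forall j, f j x @[x --> F] --> l j) ->
  \sum_(j <- r) f j x @[x --> F] --> \sum_(j <- r) l j.
Proof.
move=> fl; elim: r => [|j r IH].
  under eq_fun do rewrite big_nil.
  by rewrite big_nil; exact: cvg_cst.
under eq_fun do rewrite big_cons.
by rewrite big_cons; exact: cvgD.
Qed.

Lemma is_derive_cexpM (R : realType) (c k t : R) :
  is_derive t 1 (fun s => c * expR (k * s)) (c * k * expR (k * t)).
Proof.
have hk : is_derive t 1 (fun s : R => k * s) k.
  by apply: is_derive_eq; rewrite /GRing.scale/= mulr1 ?mulr0 ?addr0.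
have h := is_derive1_comp (is_derive_expR (k * t)) hk.
apply: (is_derive_eq (is_deriveZ c h)).
by rewrite /GRing.scale/= mulrA mulrAC.
Qed.

(** * Picard iteration for a bounded, globally Lipschitz autonomous field *)

Section Picard.
Variables (R : realType) (I : finType).
Implicit Types (z : R -> I -> R) (x y : I -> R).

Definition l1dist x y : R := \sum_i `|x i - y i|.

Lemma l1dist_ge0 x y : 0 <= l1dist x y.
Proof. exact: sumr_ge0. Qed.

Lemma le_l1dist x y i : `|x i - y i| <= l1dist x y.
Proof. by rewrite /l1dist (bigD1 i)//= lerDl sumr_ge0. Qed.

Lemma l1dist_le x y (c : R) : (forall i, `|x i - y i| <= c) ->
  l1dist x y <= #|I|%:R * c.
Proof.
move=> h; rewrite mulr_natl -sumr_const; exact: ler_sum.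
Qed.

Variables (g : I -> (I -> R) -> R) (L G : R).
Hypotheses (L_ge0 : 0 <= L) (G_ge0 : 0 <= G).
Hypothesis gL : forall i x y, `|g i x - g i y| <= L * l1dist x y.
Hypothesis gG : forall i x, `|g i x| <= G.
Variable x0 : I -> R.

(** This invariant of the iteration makes the integrand of the next Picard step continuous. *)
Let lipG z := forall i (s t : R), 0 <= s -> 0 <= t ->
  `|z s i - z t i| <= G * `|s - t|.

(** Replacing s by [|s|] extends the integrand evenly to negative times, which keeps it continuous
    across 0 and makes the derivative of a step at 0 two-sided. *)
Let step z (t : R) i : R := x0 i + primitive (fun s => g i (z `|s|)) t.

Let step0 z : step z 0 = x0.
Proof. by apply/funext => i; rewrite /step primitive0 addr0. Qed.

Let step_derive z i (t : R) : lipG z -> 0 <= t ->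
  is_derive t 1 ((step z)^~ i) (g i (z t)).
Proof.
move=> zG t0; rewrite -[g i (z t)]add0r; apply: is_deriveD.
rewrite -[in g i (z t)](ger0_norm t0).
apply: (@is_derive_primitive _ (fun s => g i (z `|s|))); last first.
  exact: lt_le_trans t0.
apply: (@lipschitz_continuous _ _ (L * (#|I|%:R * G))) => s u.
apply: (le_trans (gL _ _ _)); rewrite -!mulrA ler_wpM2l//.
apply: l1dist_le => j; apply: (le_trans (zG _ _ _ _ _)) => //.
by rewrite ler_wpM2l// ler_dist_dist.
Qed.

Let step_lipG z : lipG z -> lipG (step z).
Proof.
move=> zG i s t s0 t0.
wlog st : s t s0 t0 / s <= t.
  move=> h; have [/h->//|/ltW ts] := leP s t.
  by rewrite distrC [in leRHS]distrC h.
have dz (x : R) : x \in `]s, t[%R -> is_derive x 1 ((step z)^~ i) (g i (z x)).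
  by rewrite in_itv/= => /andP[/ltW sx _]; apply: step_derive => //;
    exact: le_trans sx.
have [] := MVT_segment st dz.
  apply: derivable_within_continuous => x; rewrite in_itv/= => /andP[sx _].
  by have [] := @step_derive z i x zG (le_trans s0 sx).
move=> c _ e; rewrite distrC [X in `|X|]e normrM ler_pM//.
by rewrite distrC.
Qed.

(* A Picard step halves distances weighted by [expR (- lam * t)]. *)
Let lam : R := 2 * #|I|%:R * L + 1.

Let lam_gt0 : 0 < lam.
Proof. by rewrite ltr_wpDl// !mulr_ge0. Qed.

(** Integrating [L * C * expR (lam * t)] gains a factor [lam^-1], summing over the coordinates costs
    a factor [#|I|], and [lam >= 2 * #|I| * L] leaves at most one half. *)
Let step_contract z z' (C : R) : lipG z -> lipG z' ->
  (forall t : R, 0 <= t -> l1dist (z t) (z' t) <= C * expR (lam * t)) ->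
  forall t : R, 0 <= t ->
    l1dist (step z t) (step z' t) <= C / 2 * expR (lam * t).
Proof.
move=> zG zG' zC t t0.
have C0 : 0 <= C.
  have := zC 0 (lexx _); rewrite mulr0 expR0 mulr1.
  exact/le_trans/l1dist_ge0.
have key i : `|step z t i - step z' t i| <= L * C / lam * expR (lam * t).
  pose F (t : R) := step z t i - step z' t i.
  apply: (@le_norm_of_derive _ F (fun s => g i (z s) - g i (z' s))
    (fun s => L * C / lam * expR (lam * s)) (fun s => L * (C * expR (lam * s)))).
  - by [].
  - by rewrite /F !step0 subrr.
  - by rewrite mulr_ge0 ?expR_ge0// divr_ge0 ?mulr_ge0// ltW.
  - by move=> x x0'; apply: is_deriveB; exact: step_derive.
  - move=> x _; have /is_derive_eq := is_derive_cexpM (L * C / lam) lam x.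
    by apply; field; exact: lt0r_neq0.
  - move=> x x0'; apply: (le_trans (gL _ _ _)); rewrite ler_wpM2l//.
    exact: zC.
apply: (le_trans (l1dist_le key)).
rewrite mulrA ler_wpM2r ?expR_ge0//.
rewrite mulrA mulrA ler_pdivrMr// /lam.
have : 0 <= #|I|%:R * L * C by rewrite !mulr_ge0.
by nra.
Qed.

Let pic k := iter k step (fun _ => x0).

Let pic_lipG k : lipG (pic k).
Proof.
elim: k => [|k IH]; last exact: step_lipG.
by move=> i s t _ _; rewrite /= subrr normr0 mulr_ge0.
Qed.

Let pic_steps : exists C : R, forall k (t : R), 0 <= t ->
  l1dist (pic k.+1 t) (pic k t) <= C * 2^-1 ^+ k * expR (lam * t).
Proof.
(* The first step moves each coordinate at speed at most [G <= G * expR (lam * t)], whose integral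
   is bounded by [G / lam * expR (lam * t)]. *)
exists (#|I|%:R * (G / lam)); elim=> [|k IH] t t0; last first.
  apply: (le_trans (step_contract _ _ IH _)) => //; try exact: pic_lipG.
  by rewrite exprS (mulrC 2^-1) !mulrA.
rewrite expr0 mulr1 -mulrA; apply: l1dist_le => i.
apply: (@le_norm_of_derive _ (fun t => pic 1 t i - x0 i)
  (fun s => g i x0) (fun s => G / lam * expR (lam * s))
  (fun s => G * expR (lam * s))).
- by [].
- by rewrite /pic/= step0 subrr.
- by rewrite mulr_ge0 ?expR_ge0// divr_ge0// ltW.
- move=> x x0'; rewrite -[g i x0]subr0; apply: is_deriveB.
  exact: (@step_derive (fun _ => x0) i x (@pic_lipG 0)).
- move=> x _; have /is_derive_eq := is_derive_cexpM (G / lam) lam x.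
  by apply; field; exact: lt0r_neq0.
- move=> x x0'; apply: (le_trans (gG _ _)).
  by rewrite ler_peMr// -expR0 ler_expR mulr_ge0// ltW.
Qed.

Lemma picard_lindelof : exists z, z 0 = x0 /\
  forall i (t : R), 0 <= t -> is_derive t 1 (z^~ i) (g i (z t)).
Proof.
have [C picC] := pic_steps.
have /choice [z zP] : forall t : R, exists x, 0 <= t -> forall i k,
    `|pic k t i - x i| <= 2 * (C * expR (lam * t)) * 2^-1 ^+ k.
  move=> t; have [t0|_] := boolP (0 <= t); last by exists x0.
  suff /choice [x xP] : forall i, exists l, forall k,
    `|pic k t i - l| <= 2 * (C * expR (lam * t)) * 2^-1 ^+ k.
    by exists x => _.
  move=> i; apply: cvg_geometric_steps => k.
  apply: (le_trans (le_l1dist _ _ _)); apply: (le_trans (picC _ _ _)) => //.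
  by rewrite mulrAC.
have zG : lipG z.
  move=> i s t s0 t0; rewrite -subr_le0.
  apply: (@le0_of_le_geometric _ _
    (2 * (C * expR (lam * s)) + 2 * (C * expR (lam * t)))) => k.
  have := pic_lipG k i s0 t0.
  have := zP s s0 i k; have := zP t t0 i k.
  by rewrite lerBlDr (mulrDl _ _ (2^-1 ^+ k)) !ler_norml; lra.
(* The limit is a fixed point: [step z] is close to [step (pic k) = pic k.+1] by the contraction,
   and so is [z], both with errors that are geometric in k. *)
have stepz t : 0 <= t -> step z t = z t.
  move=> t0; apply/funext => i; apply/eqP; rewrite -subr_eq0 -normr_le0.
  apply: (@le0_of_le_geometric _ _
    ((#|I|%:R * (2 * C) / 2 * expR (lam * t)) + (C * expR (lam * t)))) => k.
  have := zP t t0 i k.+1.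
  have : l1dist (step z t) (pic k.+1 t) <=
      (#|I|%:R * (2 * C * 2^-1 ^+ k)) / 2 * expR (lam * t).
    apply: (@step_contract z (pic k) _ zG (@pic_lipG k)) => // s s0.
    rewrite -mulrA; apply: l1dist_le => j.
    by rewrite distrC mulrAC -(mulrA 2); exact: zP.
  move=> /(le_trans (le_l1dist _ _ i)).
  set a := step z t i; set b := pic k.+1 t i; set c := z t i => h1 h2.
  rewrite (le_trans (ler_distD b _ _))// (le_trans (lerD h1 h2))//.
  by rewrite exprS le_eqVlt; apply/orP; left; apply/eqP; field.
(* [z] is arbitrary at negative times, whereas [step z] agrees with it on the half-line and has a
   two-sided derivative at 0. *)
exists (step z); split => // i t t0.
by rewrite stepz//; exact: step_derive.
Qed.

End Picard.

Lemma gronwall_unique (R : realType) (I : finType) (z1 z2 : R -> I -> R)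
    (d1 d2 : R -> I -> R) (L T : R) : 0 <= T ->
  (forall i, {within `[0, T], continuous z1^~ i}) ->
  (forall i, {within `[0, T], continuous z2^~ i}) ->
  (forall i (t : R), 0 < t < T -> is_derive t 1 (z1^~ i) (d1 t i)) ->
  (forall i (t : R), 0 < t < T -> is_derive t 1 (z2^~ i) (d2 t i)) ->
  (forall i (t : R), 0 < t < T ->
     `|d1 t i - d2 t i| <= L * l1dist (z1 t) (z2 t)) ->
  z1 0 = z2 0 -> z1 T = z2 T.
Proof.
move=> T0 c1 c2 D1 D2 dL z0.
(* Gronwall for the squared Euclidean distance, which unlike the l1 one is
   differentiable. *)
pose phi (t : R) := \sum_i (z1 t i - z2 t i) ^+ 2.
(* [2 * e i * e j <= e i ^+ 2 + e j ^+ 2], summed over all pairs of coordinates, yields the factor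
   [2 * #|I|]. The minus sign in [psi] turns decay into growth, to fit the monotonicity lemma. *)
pose K := 2 * `|L| * #|I|%:R.
pose psi (t : R) := - (phi t * expR (- K * t)).
pose dphi (t : R) := \sum_i 2 * (z1 t i - z2 t i) * (d1 t i - d2 t i).
have phiD (t : R) : 0 < t < T -> is_derive t 1 phi (dphi t).
  move=> tT.
  apply: is_derive_bigsum => i.
  have := D1 i t tT; have := D2 i t tT => h2 h1.
  have h := is_deriveB h1 h2.
  by apply: (is_derive_eq (is_derive_mulr h h)); rewrite !(addrfctE, opprfctE);
    ring.
have phi0 t : 0 <= phi t by apply: sumr_ge0 => i _; exact: sqr_ge0.
have dphiK (t : R) : 0 < t < T -> dphi t <= K * phi t.
  move=> tT; pose e i : R := `|z1 t i - z2 t i|.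
  have e2 : \sum_i e i ^+ 2 = phi t.
    by apply: eq_bigr => i _; rewrite /e real_normK ?num_real.
  apply: (@le_trans _ _ (\sum_i \sum_j `|L| * (e i ^+ 2 + e j ^+ 2))).
    apply: ler_sum => i _.
    apply: (@le_trans _ _ (2 * e i * (`|L| * \sum_j e j))).
      apply: (le_trans (ler_norm _)).
      rewrite normrM (normrM 2) (ger0_norm (ler0n R 2)).
      rewrite ler_wpM2l ?mulr_ge0//; apply: (le_trans (dL _ _ tT)).
      by rewrite ler_wpM2r ?l1dist_ge0// ler_norm.
    rewrite !mulr_sumr; apply: ler_sum => j _.
    have := mulr_ge0 (normr_ge0 L) (sqr_ge0 (e i - e j)).
    by nra.
  under eq_bigr do rewrite -mulr_sumr big_split/= sumr_const e2.
  rewrite -mulr_sumr big_split/= sumr_const sumrMnl e2 -(mulr_natl (phi t)) /K.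
  by lra.
have psi_le : psi 0 <= psi T.
  apply: (@le_of_derive_ge0 _ psi
    (fun t => (K * phi t - dphi t) * expR (- K * t))) => //.
  - move=> t tT; have h := is_derive_cexpM 1 (- K) t.
    have := is_deriveN (is_derive_mulr (phiD t tT) h).
    under [X in is_derive _ _ X _]eq_fun do rewrite /= mul1r.
    by move/is_derive_eq; apply; ring.
  - by move=> t tT; rewrite mulr_ge0 ?expR_ge0// subr_ge0; exact: dphiK.
  - have ce : {within `[0, T], continuous (fun t : R => expR (- K * t))}.
      apply: continuous_subspaceT => s.
      apply: continuous_comp; last exact: continuous_expR.
      by apply: cvgM; [exact: cvg_cst|exact: cvg_id].
    move=> t; apply: cvgN; apply: cvgM; last exact: ce.
    apply: cvg_bigsum => i.
    by apply: cvgM; apply: cvgB; [exact: c1|exact: c2|exact: c1|exact: c2].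
have phi00 : phi 0 = 0.
  by rewrite /phi big1// => i _; rewrite z0 subrr expr0n.
have : phi T = 0.
  apply/eqP; rewrite eq_le phi0 andbT.
  move: psi_le; rewrite /psi phi00 mul0r oppr0 oppr_ge0.
  by rewrite pmulr_lle0// expR_gt0.
move=> /eqP; rewrite psumr_eq0; last by move=> i _; exact: sqr_ge0.
move=> /allP h; apply/funext => i; apply/eqP; rewrite -subr_eq0.
by have := h i (mem_index_enum i); rewrite sqrf_eq0.
Qed.

(** * Bounded Lipschitz functions on a box *)

Section BoundedLipschitz.
Variables (R : realType) (I : finType) (X : Type).
Variables (B : set (I -> R)) (D : set X).
Implicit Types (f h : (I -> R) -> X -> R) (z : I -> R) (x : X).

(* Boundedness makes the class stable under products. *)
Definition blip f : Prop := exists C : R, [/\ 0 <= C,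
  forall z x, B z -> D x -> `|f z x| <= C &
  forall z z' x, B z -> B z' -> D x -> `|f z x - f z' x| <= C * l1dist z z'].

Lemma blip_eq f h : (forall z x, B z -> D x -> f z x = h z x) ->
  blip h -> blip f.
Proof.
move=> fh [C [C0 hC hL]]; exists C; split => // [z x Bz Dx|z z' x Bz Bz' Dx].
  by rewrite fh//; exact: hC.
by rewrite !fh//; exact: hL.
Qed.

Lemma blip_cst (k : X -> R) (C : R) : (forall x, D x -> `|k x| <= C) ->
  blip (fun _ x => k x).
Proof.
move=> kC; exists `|C|; split => // [z x _ Dx|z z' x _ _ _].
  exact/(le_trans (kC _ Dx))/ler_norm.
by rewrite subrr normr0 mulr_ge0// l1dist_ge0.
Qed.

Lemma blipD f h : blip f -> blip h -> blip (fun z x => f z x + h z x).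
Proof.
move=> [C [C0 fC fL]] [E [E0 hC hL]]; exists (C + E); split.
- exact: addr_ge0.
- move=> z x Bz Dx.
  by rewrite (le_trans (ler_normD _ _))// lerD ?fC ?hC.
- move=> z z' x Bz Bz' Dx; rewrite opprD addrACA.
  by rewrite (le_trans (ler_normD _ _))// mulrDl lerD ?fL ?hL.
Qed.

Lemma blipM f h : blip f -> blip h -> blip (fun z x => f z x * h z x).
Proof.
move=> [C [C0 fC fL]] [E [E0 hC hL]]; exists (C * E + C * E).
have CE : 0 <= C * E by rewrite mulr_ge0.
split => [|z x Bz Dx|z z' x Bz Bz' Dx].
- exact: addr_ge0.
- by rewrite normrM -[leLHS]addr0 lerD// ler_pM ?fC ?hC.
- rewrite (_ : _ - _ = (f z x - f z' x) * h z x + f z' x * (h z x - h z' x)).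
    rewrite (le_trans (ler_normD _ _))// !normrM mulrDl lerD//.
      by rewrite (mulrAC C) ler_pM ?fL ?hC.
    by rewrite -mulrA ler_pM ?hL ?fC.
  by ring.
Qed.

Lemma blipZ (c : R) f : blip f -> blip (fun z x => c * f z x).
Proof. by move=> hf; apply: blipM => //; exact: (@blip_cst _ `|c|). Qed.

Lemma blipN f : blip f -> blip (fun z x => - f z x).
Proof.
by move=> hf; apply: (blip_eq _ (blipZ (-1) hf)) => z x _ _; rewrite mulN1r.
Qed.

Lemma blipB f h : blip f -> blip h -> blip (fun z x => f z x - h z x).
Proof. by move=> hf hh; apply: blipD => //; exact: blipN. Qed.

Lemma blip_sum (J : Type) (r : seq J) (f : J -> (I -> R) -> X -> R) :
  (forall j, blip (f j)) -> blip (fun z x => \sum_(j <- r) f j z x).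
Proof.
move=> fb; elim: r => [|j r IH].
  apply: (@blip_eq _ (fun _ _ => 0)) => [z x _ _|]; first by rewrite big_nil.
  by apply: (@blip_cst _ 0) => x _; rewrite normr0.
apply: (@blip_eq _ (fun z x => f j z x + \sum_(j <- r) f j z x)).
  by move=> z x _ _; rewrite big_cons.
exact: blipD.
Qed.

Lemma blip_prod (J : Type) (r : seq J) (f : J -> (I -> R) -> X -> R) :
  (forall j, blip (f j)) -> blip (fun z x => \prod_(j <- r) f j z x).
Proof.
move=> fb; elim: r => [|j r IH].
  apply: (@blip_eq _ (fun _ _ => 1)) => [z x _ _|]; first by rewrite big_nil.
  by apply: (@blip_cst _ 1) => x _; rewrite normr1.
apply: (@blip_eq _ (fun z x => f j z x * \prod_(j <- r) f j z x)).
  by move=> z x _ _; rewrite big_cons.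
exact: blipM.
Qed.

Lemma blip_comp (S : set R) (phi : X -> R -> R) (C : R) f :
  (forall x r, D x -> S r -> `|phi x r| <= C) ->
  (forall x r s, D x -> S r -> S s -> `|phi x r - phi x s| <= C * `|r - s|) ->
  (forall z x, B z -> D x -> S (f z x)) ->
  blip f -> blip (fun z x => phi x (f z x)).
Proof.
move=> pC pL fS [E [E0 fE fL]]; exists (`|C| + `|C| * E); split.
- by rewrite addr_ge0 ?mulr_ge0.
- move=> z x Bz Dx; rewrite (le_trans (pC _ _ Dx (fS _ _ Bz Dx)))//.
  by rewrite (le_trans (ler_norm C))// lerDl mulr_ge0.
- move=> z z' x Bz Bz' Dx.
  apply: (le_trans (pL _ _ _ Dx (fS _ _ Bz Dx) (fS _ _ Bz' Dx))).
  apply: (@le_trans _ _ (`|C| * (E * l1dist z z'))).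
    apply: (@le_trans _ _ (`|C| * `|f z x - f z' x|)).
      by rewrite ler_wpM2r// ler_norm.
    by rewrite ler_wpM2l// fL.
  by rewrite mulrDl mulrA lerDr mulr_ge0 ?l1dist_ge0.
Qed.

Lemma blip_norm f : blip f -> blip (fun z x => `|f z x|).
Proof.
move=> [C [C0 fC fL]]; exists C; split => // [z x Bz Dx|z z' x Bz Bz' Dx].
  by rewrite normr_id fC.
by rewrite (le_trans (ler_dist_dist _ _))// fL.
Qed.

Lemma blipV f (d : R) : 0 < d -> (forall z x, B z -> D x -> d <= `|f z x|) ->
  blip f -> blip (fun z x => (f z x)^-1).
Proof.
(* One constant has to serve twice: [d^-1] bounds the inverse and [d^-1 * d^-1] is its Lipschitz
   constant. *)
move=> d0 fd; apply: (@blip_comp [set r | d <= `|r|] (fun _ r => r^-1)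
  (d^-1 + d^-1 * d^-1)) => //.
- move=> x r _ /= dr; rewrite normfV -[leLHS]addr0 lerD//; last first.
    by rewrite mulr_ge0// invr_ge0 ltW.
  by rewrite lef_pV2// posrE// (lt_le_trans d0).
- move=> x r s _ /= dr ds.
  have r0 : r != 0 by rewrite -normr_gt0 (lt_le_trans d0).
  have s0 : s != 0 by rewrite -normr_gt0 (lt_le_trans d0).
  rewrite (_ : r^-1 - s^-1 = r^-1 * s^-1 * (s - r)); last by field; rewrite r0 s0.
  rewrite normrM (distrC s) ler_wpM2r// normrM !normfV.
  have hV (u : R) : d <= `|u| -> `|u|^-1 <= d^-1.
    by move=> du; rewrite lef_pV2// posrE// (lt_le_trans d0).
  rewrite -[leLHS]add0r lerD ?invr_ge0 ?(ltW d0)//.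
  by rewrite ler_pM ?invr_ge0 ?hV.
Qed.

End BoundedLipschitz.

(** Functions of the state alone. The parameter of [blip] is meant for the point of the network,
    uniformly in which an integrand has to be Lipschitz in the state. *)
Definition blips (R : realType) (I : finType) (B : set (I -> R))
  (f : (I -> R) -> R) : Prop := blip B [set: unit] (fun z _ => f z).

(** * Boxes: clipping, compactness, inverse matrices *)

Section Box.
Variables (R : realType) (I : finType) (lo hi : I -> R).
Implicit Types z : I -> R.

Definition box : set (I -> R) := [set z | forall i, lo i <= z i <= hi i].

Definition clip z i : R := Num.max (lo i) (Num.min (hi i) (z i)).

Lemma clip_id z : box z -> clip z = z.
Proof.
move=> bz; apply/funext => i; have /andP[l h] := bz i.
by rewrite /clip (min_idPr h) (max_idPr l).
Qed.

Lemma clip_box z : (forall i, lo i <= hi i) -> box (clip z).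
Proof.
by move=> lh i; rewrite /clip le_max lexx/= ge_max lh ge_min lexx.
Qed.

Lemma l1dist_clip z z' : l1dist (clip z) (clip z') <= l1dist z z'.
Proof.
apply: ler_sum => i _; rewrite /clip.
have hmax (l u v : R) : `|Num.max l u - Num.max l v| <= `|u - v|.
  have := ler_norm (u - v); have := ler_norm (- (u - v)); rewrite normrN ler_norml.
  by case: (leP l u) => ?; case: (leP l v) => ?; lra.
have hmin (l u v : R) : `|Num.min l u - Num.min l v| <= `|u - v|.
  have := ler_norm (u - v); have := ler_norm (- (u - v)); rewrite normrN ler_norml.
  by case: (leP l u) => ?; case: (leP l v) => ?; lra.
exact: le_trans (hmax _ _ _) (hmin _ _ _).
Qed.

Lemma blip_coord (X : Type) (D : set X) (i : I) :
  blip box D (fun z _ => z i).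
Proof.
exists (`|lo i| + `|hi i| + 1); split => [|z x bz _|z z' x _ _ _].
- by rewrite !addr_ge0.
- have /andP[l h] := bz i.
  have := ler_norm (hi i); have := ler_norm (- lo i).
  have := normr_ge0 (lo i); have := normr_ge0 (hi i).
  by rewrite normrN ler_norml; lra.
- rewrite (le_trans (le_l1dist _ _ _))// ler_peMl ?l1dist_ge0//.
  by rewrite lerDr addr_ge0.
Qed.

(** A Lipschitz function is continuous for the product topology, in which the box is compact by
    Tychonoff, so [|f|] attains its minimum. Determinants are thus bounded below without being
    estimated. *)
Lemma blips_bounded_away f : blips box f -> (forall z, box z -> f z != 0) ->
  exists2 d : R, 0 < d & forall z, box z -> d <= `|f z|.
Proof.
move=> [C [C0 _ fL]] f0.
have [b0|/nonemptyPn b0] := pselect (box !=set0); last first.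
  by exists 1 => // z bz; exfalso; move: bz; rewrite b0.
have cb : compact (box : set (prod_topology (fun _ : I => R))).
  have <- : [set f : I -> R | forall i, `[lo i, hi i]%classic (f i)] = box.
    by apply/seteqP; split => z bz i; have := bz i; rewrite /= in_itv.
  exact: (@tychonoff I (fun _ => R) (fun i => `[lo i, hi i]%classic)
    (fun i => @segment_compact R _ _)).
have cf : {within (box : set (prod_topology (fun _ : I => R))),
    continuous (fun z => `|f z|)}.
  apply/subspace_continuousP => z bz.
  apply/cvgrPdist_le => e e0.
  have FF : Filter (nbhs (z : prod_topology (fun _ : I => R))) := nbhs_filter _.
  have dz : l1dist z y @[y --> (z : prod_topology (fun _ : I => R))] --> (0 : R).
    rewrite (_ : 0 = \sum_(i : I) `|z i - z i|); last first.
      by rewrite big1// => i _; rewrite subrr normr0.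
    apply: (@cvg_bigsum R _ _ FF) => i.
    have pz : (y i : R) @[y --> (z : prod_topology (fun _ : I => R))] --> z i.
      exact: (@proj_continuous I (fun _ => R) i z).
    exact: (cvg_norm (cvgB (cvg_cst (z i)) pz)).
  have C1 : 0 < C + 1 by rewrite ltr_wpDl.
  have /cvgrPdist_le/(_ (e / (C + 1))) := dz.
  rewrite divr_gt0// => /(_ isT) dz'.
  suff h : nbhs (z : prod_topology (fun _ : I => R))
    [set y | box y -> `| `|f z| - `|f y| | <= e] by exact: h.
  apply: filterS dz' => y; rewrite sub0r normrN ger0_norm ?l1dist_ge0// => yd by_.
  rewrite (le_trans (ler_dist_dist _ _))// (le_trans (fL _ _ tt bz by_ _))//.
  apply: (@le_trans _ _ ((C + 1) * l1dist z y)).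
    by rewrite ler_wpM2r ?l1dist_ge0// lerDl.
  by rewrite mulrC -ler_pdivlMr.
have [c] := @compact_EVT_min (prod_topology (fun _ : I => R)) _ _ _ b0 cb cf.
rewrite inE => bc cmin; exists `|f c|; first by rewrite normr_gt0 f0.
by move=> z bz; apply: cmin; rewrite inE.
Qed.

Lemma blips_det n (A : (I -> R) -> 'M[R]_n) :
  (forall i j, blips box (fun z => A z i j)) -> blips box (fun z => \det (A z)).
Proof.
move=> hA; rewrite /determinant; apply: blip_sum => s.
by apply: blipZ; apply: blip_prod => i; exact: hA.
Qed.

(** By the adjugate formula the entries of the inverse are polynomials in the entries of [A z],
    divided by a determinant that is bounded away from 0 on the box. *)
Lemma blips_invmx n (A : (I -> R) -> 'M[R]_n) :
  (forall i j, blips box (fun z => A z i j)) ->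
  (forall z, box z -> A z \in unitmx) ->
  forall i j, blips box (fun z => invmx (A z) i j).
Proof.
move=> hA Au i j.
have [z bz|d d0 dA] := blips_bounded_away (blips_det hA).
  by have := Au z bz; rewrite unitmxE unitfE.
apply: (@blip_eq _ _ _ _ _ _ (fun z _ => (\det (A z))^-1 * \adj (A z) i j)).
  by move=> z _ bz _; rewrite /invmx Au// mxE.
apply: blipM.
  by apply: (blipV d0 _ (blips_det hA)) => z _ bz _; exact: dA.
apply: (@blip_eq _ _ _ _ _ _ (fun z _ => cofactor (A z) j i)).
  by move=> z _ _ _; rewrite mxE.
rewrite /cofactor; apply: blipZ.
by apply: blips_det => k l; apply: (blip_eq _ (hA _ _)) => z _ _ _; rewrite !mxE.
Qed.

End Box.

Lemma lipschitz_of_derive (R : realType) (phi dphi : R -> R) (a b : R) :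
  (forall x : R, a <= x <= b -> is_derive x 1 phi (dphi x)) ->
  forall C, (forall x, a <= x <= b -> `|dphi x| <= C) ->
  forall r s, a <= r <= b -> a <= s <= b -> `|phi r - phi s| <= C * `|r - s|.
Proof.
move=> pd C dC r s rab sab.
wlog rs : r s rab sab / r <= s.
  move=> h; have [/h->//|/ltW sr] := leP r s.
  by rewrite distrC [in leRHS]distrC h.
have sub x : r <= x <= s -> a <= x <= b by lra.
have pd' (x : R) : x \in `]r, s[%R -> is_derive x 1 phi (dphi x).
  by rewrite in_itv/= => /andP[rx xs]; apply: pd; apply: sub; rewrite !ltW.
have [] := MVT_segment rs pd'.
  apply: derivable_within_continuous => x; rewrite in_itv/= => xrs.
  by have [] := pd x (sub _ xrs).
move=> c; rewrite in_itv/= => crs e.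
rewrite distrC e normrM distrC (distrC r) ler_wpM2r// dC//.
exact: sub.
Qed.

(** The exponent may have either sign, so the bound comes from compactness instead of
    monotonicity. *)
Lemma powR_bounded (R : realType) (s a b : R) : 0 < a ->
  exists2 C : R, 0 <= C & forall x, a <= x <= b -> `|x `^ s| <= C.
Proof.
move=> a0; have [ab|ab] := leP a b; last by exists 0 => // x; lra.
have [|c _ cmax] := @EVT_max R (fun x => x `^ s) a b ab.
  apply: derivable_within_continuous => x; rewrite in_itv/= => /andP[ax _].
  by have [] := @is_derive1_powR R s x (lt_le_trans a0 ax).
exists (c `^ s) => [|x xab]; first exact: powR_ge0.
by rewrite ger0_norm ?powR_ge0//; apply: cmax; rewrite in_itv.
Qed.

Lemma powR_lipschitz (R : realType) (s a b : R) : 0 < a ->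
  exists C : R, (forall x, a <= x <= b -> `|x `^ s| <= C) /\
  (forall x y, a <= x <= b -> a <= y <= b ->
     `|x `^ s - y `^ s| <= C * `|x - y|).
Proof.
move=> a0; have [C C0 hC] := powR_bounded s b a0.
have [E E0 hE] := powR_bounded (s - 1) b a0.
exists (C + `|s| * E); split => [x /hC/le_trans->//|].
  by rewrite lerDl mulr_ge0.
apply: (@lipschitz_of_derive _ _ (fun x => s * x `^ (s - 1))).
  move=> x /andP[ax _]; apply: is_derive1_powR; exact: lt_le_trans ax.
move=> x xab; rewrite normrM -[leLHS]add0r lerD//.
by rewrite ler_wpM2l ?hE.
Qed.

(** * Finite element functions *)

Section FiniteElements.
Variables (R : realType) (G : network R) (N : edge G -> nat).
Hypothesis N_gt0 : forall e, (0 < N e)%N.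
Local Notation mu := (@lebesgue_measure R).
Local Notation mesh e i := (@mesh_point R G N e i).

Definition elt (e : edge G) (i : 'I_(N e)) : element N :=
  Tagged (fun e => 'I_(N e)) i.

Let step_gt0 (e : edge G) : 0 < len e / (N e)%:R :> R.
Proof. by rewrite divr_gt0 ?len_gt0// ltr0n. Qed.

Lemma mesh_le (e : edge G) i j : (i <= j)%N -> mesh e i <= mesh e j.
Proof. by move=> ij; rewrite /mesh_point ler_wpM2r ?ler_nat// ltW. Qed.

Lemma mesh_lt (e : edge G) i j : (i < j)%N -> mesh e i < mesh e j.
Proof. by move=> ij; rewrite /mesh_point ltr_pM2r ?ltr_nat. Qed.

Lemma mesh0 (e : edge G) : mesh e 0 = 0.
Proof. by rewrite /mesh_point mul0r. Qed.

Lemma meshN (e : edge G) : mesh e (N e) = len e.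
Proof. by rewrite /mesh_point mulrC divfK// pnatr_eq0 -lt0n. Qed.

Lemma in_element_uniq (e : edge G) (i j : 'I_(N e)) x :
  in_element i x -> in_element j x -> i = j.
Proof.
wlog ij : i j / (i < j)%N.
  move=> h ix jx; apply/val_inj; case: (ltngtP i j) => // [ij|ji].
    by rewrite (h i j).
  by rewrite (h j i).
move=> /andP[_ xi] /andP[jx _]; exfalso.
(* As [i < j], the element [i] is not the last one of its edge, hence it does not contain its right
   end. *)
move: xi; have /negbTE -> : i.+1 != N e.
  by rewrite neq_ltn; apply/orP; left; exact: leq_ltn_trans ij (ltn_ord j).
by move=> /= /(le_lt_trans jx); apply/negP; rewrite -leNgt mesh_le.
Qed.

Lemma in_element_ex (e : edge G) x : 0 <= x <= len e ->
  exists i : 'I_(N e), in_element i x.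
Proof.
move=> /andP[x0 xl].
(* The element sought is the last one whose left end does not exceed [x]. *)
pose P i := (i < N e)%N && (mesh e i <= x).
have P0 : exists i, P i by exists 0%N; rewrite /P N_gt0 mesh0.
have Pmax i : P i -> (i <= N e)%N by move=> /andP[/ltnW].
case: (ex_maxnP P0 Pmax) => i /andP[iN ix] imax.
exists (Ordinal iN); rewrite /in_element ix/=.
have [->|iN'] /= := eqVneq i.+1 (N e); first by rewrite meshN.
rewrite ltNge; apply/negP => ix'.
have /imax : P i.+1 by rewrite /P ix' andbT ltn_neqAle iN' iN.
by rewrite ltnn.
Qed.

Lemma fe_fun_elt k (u : fe_space N k) (e : edge G) (i : 'I_(N e)) x :
  in_element i x -> fe_fun u e x = (fe_poly u (elt i)).[x].
Proof.
move=> ix; rewrite /fe_fun (big_pred1 i)// => j /=.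
by apply/idP/eqP => [/in_element_uniq -/(_ _ ix)//|->].
Qed.

Lemma in_element_interior (e : edge G) (i : 'I_(N e)) x :
  mesh e i < x < mesh e i.+1 -> in_element i x.
Proof.
by move=> /andP[ix xi]; rewrite /in_element (ltW ix)/=; apply: lteifS.
Qed.

Lemma in_element_bound (e : edge G) (i : 'I_(N e)) x :
  in_element i x -> 0 <= x <= len e.
Proof.
move=> /andP[ix xi]; rewrite (le_trans _ ix)/=; last by rewrite -(mesh0 e) mesh_le.
by rewrite (le_trans (lteifW xi))// -meshN mesh_le.
Qed.

Lemma in_element_left (e : edge G) (i : 'I_(N e)) :
  in_element i (mesh e i).
Proof. by rewrite /in_element lexx/=; apply: lteifS; exact: mesh_lt. Qed.

Lemma fe_fun0 k e x : fe_fun (0 : fe_space N k) e x = 0.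
Proof.
rewrite /fe_fun big1// => i _.
by rewrite /fe_poly row0 raddf0 horner0.
Qed.

Lemma fe_fun_lin k a (u v : fe_space N k) e x :
  fe_fun (a *: u + v) e x = a * fe_fun u e x + fe_fun v e x.
Proof.
rewrite /fe_fun mulr_sumr -big_split/=; apply: eq_bigr => i _.
by rewrite /fe_poly !linearP/= hornerD hornerZ.
Qed.

Lemma fe_funD k (u v : fe_space N k) e x :
  fe_fun (u + v) e x = fe_fun u e x + fe_fun v e x.
Proof. by rewrite -[u]scale1r fe_fun_lin scale1r mul1r. Qed.

Lemma fe_funZ k a (u : fe_space N k) e x :
  fe_fun (a *: u) e x = a * fe_fun u e x.
Proof. by rewrite -[a *: u]addr0 fe_fun_lin fe_fun0 addr0. Qed.

Lemma fe_funN k (u : fe_space N k) e x : fe_fun (- u) e x = - fe_fun u e x.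
Proof. by rewrite -scaleN1r fe_funZ mulN1r. Qed.

Lemma fe_fun_sum k (J : Type) (r : seq J) (u : J -> fe_space N k) e x :
  fe_fun (\sum_(j <- r) u j) e x = \sum_(j <- r) fe_fun (u j) e x.
Proof.
elim: r => [|j r IH]; first by rewrite !big_nil fe_fun0.
by rewrite !big_cons fe_funD IH.
Qed.

Lemma fe_fun0_elt (r : Qh N) (e : edge G) (i : 'I_(N e)) x :
  in_element i x -> fe_fun r e x = r (enum_rank (elt i)) ord0.
Proof.
move=> ix; rewrite (fe_fun_elt _ ix) /fe_poly.
rewrite (@horner_coef_wide _ 1) ?size_poly//.
by rewrite big_ord1 expr0 mulr1 coef_rVpoly_ord mxE.
Qed.

Lemma fe_fun1_elt (m : fe_space N 1) (e : edge G) (i : 'I_(N e)) x :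
  in_element i x -> fe_fun m e x =
    m (enum_rank (elt i)) ord0 + m (enum_rank (elt i)) ord_max * x.
Proof.
move=> ix; rewrite (fe_fun_elt _ ix) /fe_poly.
rewrite (@horner_coef_wide _ 2) ?size_poly//.
rewrite big_ord_recl big_ord1 expr0 mulr1 expr1 !coef_rVpoly_ord !mxE.
by congr (_ + m _ _ * _); apply/val_inj.
Qed.

(** It agrees with [dx] inside the elements. Unlike [dx], it belongs to Q_h, so it can serve as a
    test function and has controlled values at the mesh points. *)
Definition slope (m : fe_space N 1) : Qh N := \matrix_(i, j) m i ord_max.

Lemma slope_lin a u v : slope (a *: u + v) = a *: slope u + slope v.
Proof. by apply/matrixP => i j; rewrite !mxE. Qed.

Lemma dx_fe_fun (m : fe_space N 1) (e : edge G) (i : 'I_(N e)) x :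
  mesh e i < x < mesh e i.+1 ->
  dx (fe_fun m) e x = fe_fun (slope m) e x.
Proof.
move=> ix; rewrite (fe_fun0_elt _ (in_element_interior ix)) mxE /dx derive1E.
set K := enum_rank _.
have h : is_derive x 1 (fun y => m K ord0 + m K ord_max * y) (m K ord_max).
  have h1 := is_deriveZ (m K ord_max) (is_derive_id x (1 : R)).
  have h2 := is_derive_cst (m K ord0) x (1 : R).
  by apply: (is_derive_eq (is_deriveD h2 h1)); rewrite /GRing.scale/= mulr1 add0r.
have [_ <-] := h.
apply: near_eq_derive.
have [h1 h2] := andP ix.
near=> y; apply: fe_fun1_elt; apply: in_element_interior; apply/andP; split.
  by near: y; exact: lt_nbhsr.
by near: y; exact: lt_nbhsl.
Unshelve. all: by end_near. Qed.

(** Functions of a piecewise constant density are again in Q_h, so measurability and boundedness of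
    1 / rho and of powers of rho come from those of finite element functions. *)
Definition mapQ (g : edge G -> R -> R) (r : Qh N) : Qh N :=
  \matrix_(i, j) g (tag (enum_val i)) (r i j).

Lemma fe_fun_mapQ g r e x : 0 <= x <= len e ->
  fe_fun (mapQ g r) e x = g e (fe_fun r e x).
Proof.
move=> /in_element_ex[i ix].
by rewrite !(fe_fun0_elt _ ix) mxE enum_rankK.
Qed.

Lemma pos_densityE (r : Qh N) : pos_density r <-> forall i j, 0 < r i j.
Proof.
split=> [rp i j|rp e x /in_element_ex[i ix]]; last by rewrite (fe_fun0_elt _ ix).
rewrite ord1 -(enum_valK i).
have [l hl] : exists l, l = enum_val i by exists (enum_val i).
rewrite -hl; case: l hl => e l _.
have hl := in_element_left l.
by have := rp e _ (in_element_bound hl); rewrite (fe_fun0_elt _ hl).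
Qed.

(* On these functions, which form an algebra, [inner] is bilinear. *)
Definition bm (u : netfun G) : Prop := forall e : edge G,
  measurable_fun (`[0, len e] : set R) (u e) /\
  exists C : R, forall x, 0 <= x <= len e -> `|u e x| <= C.

Lemma bm_eq u v : bm u -> (forall e x, v e x = u e x) -> bm v.
Proof.
by move=> bu vu; have -> : v = u by apply/funext => e; apply/funext => x.
Qed.

Lemma bm_eq_on u v : bm u ->
  (forall e x, 0 <= x <= len e -> v e x = u e x) -> bm v.
Proof.
move=> bu vu e; have [m1 [C hC]] := bu e; split.
  by apply: eq_measurable_fun m1 => x; rewrite inE/= in_itv/= => /vu.
by exists C => x xe; rewrite vu// hC.
Qed.

Lemma bm_bounded u : bm u ->
  exists C : R, forall e x, 0 <= x <= len e -> `|u e x| <= C.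
Proof.
move=> bu; have /choice[C hC] := fun e => (bu e).2.
exists (\sum_e `|C e|) => e x xe; apply: (le_trans (hC e x xe)).
by rewrite (le_trans (ler_norm _))// (bigD1 e)//= lerDl sumr_ge0.
Qed.

Lemma bm_cst (k : edge G -> R) : bm (fun e _ => k e).
Proof. by move=> e; split => //; exists `|k e|. Qed.

Lemma bmD u v : bm u -> bm v -> bm (fun e x => u e x + v e x).
Proof.
move=> bu bv e; have [mu1 [C hC]] := bu e; have [mv [E hE]] := bv e; split.
  exact: measurable_funD.
exists (C + E) => x xe.
by rewrite (le_trans (ler_normD _ _))// lerD ?hC ?hE.
Qed.

Lemma bmM u v : bm u -> bm v -> bm (fun e x => u e x * v e x).
Proof.
move=> bu bv e; have [mu1 [C hC]] := bu e; have [mv [E hE]] := bv e; split.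
  exact: measurable_funM.
by exists (C * E) => x xe; rewrite normrM ler_pM ?hC ?hE.
Qed.

Lemma bmZ (k : edge G -> R) u : bm u -> bm (fun e x => k e * u e x).
Proof. by move=> bu; apply: bmM => //; exact: bm_cst. Qed.

Lemma bmB u v : bm u -> bm v -> bm (fun e x => u e x - v e x).
Proof.
move=> bu bv; apply: (bmD bu) => e.
by have [m1 [C hC]] := bv e; split;
  [exact: measurableT_comp|exists C => x xe; rewrite normrN hC].
Qed.

Lemma bm_norm u : bm u -> bm (fun e x => `|u e x|).
Proof.
move=> bu e; have [m1 [C hC]] := bu e; split; first exact: measurableT_comp.
by exists C => x xe; rewrite normr_id hC.
Qed.

Lemma bm_sum (J : Type) (r : seq J) (u : J -> netfun G) :
  (forall j, bm (u j)) -> bm (fun e x => \sum_(j <- r) u j e x).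
Proof.
move=> bu; elim: r => [|j r IH].
  by under eq_fun do under eq_fun do rewrite big_nil; exact: (bm_cst (fun _ => 0)).
by under eq_fun do under eq_fun do rewrite big_cons; exact: bmD.
Qed.

Lemma measurable_in_element (e : edge G) (i : 'I_(N e)) :
  measurable [set x | in_element i x].
Proof.
rewrite (_ : [set x | _] = [set` Interval (BLeft (mesh e i))
    (BSide (i.+1 != N e) (mesh e i.+1))]); first exact: measurable_itv.
apply/seteqP; split => x /=; rewrite /in_element in_itv/=;
  by case: eqP.
Qed.

Lemma poly_bounded (p : {poly R}) (l : R) :
  exists C : R, forall x, 0 <= x <= l -> `|p.[x]| <= C.
Proof.
exists (\sum_(i < size p) `|p`_i| * `|l| ^+ i) => x /andP[x0 xl].
rewrite horner_coef (le_trans (ler_norm_sum _ _ _))//; apply: ler_sum => i _.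
rewrite normrM ler_wpM2l// normrX lerXn2r ?nnegrE//.
by rewrite !ger0_norm// (le_trans x0).
Qed.

Lemma bm_fe k (u : fe_space N k) : bm (fe_fun u).
Proof.
move=> e; split.
  rewrite (_ : fe_fun u e = fun x => \sum_(i <- index_enum 'I_(N e))
    \1_[set y | in_element i y] x * (fe_poly u (elt i)).[x]).
    apply: measurable_sum => i; apply: measurable_funM.
      by apply: measurable_indic; exact: measurable_in_element.
    apply: measurable_funTS; apply: continuous_measurable_fun.
    exact: continuous_horner.
  apply/funext => x; rewrite /fe_fun big_mkcond/=; apply: eq_bigr => i _.
  rewrite indicE/=; case: ifPn => ix; last by rewrite memNset ?mul0r//; exact/negP.
  by rewrite mem_set ?mul1r.
have /choice[C hC] : forall i : 'I_(N e), exists C : R,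
    forall x, 0 <= x <= len e -> `|(fe_poly u (elt i)).[x]| <= C.
  by move=> i; exact: poly_bounded.
exists (\sum_i `|C i|) => x xe.
rewrite /fe_fun big_mkcond (le_trans (ler_norm_sum _ _ _))//; apply: ler_sum => i _.
case: ifPn => _; last by rewrite normr0.
exact/(le_trans (hC _ _ xe))/ler_norm.
Qed.

Lemma bm_integrable (u : netfun G) (e : edge G) : bm u ->
  mu.-integrable `[0, len e] (EFin \o u e).
Proof.
move=> /(_ e)[m1 [C hC]]; apply: measurable_bounded_integrable => //.
  by apply: compact_finite_measure; exact: segment_compact.
exists C; split; first exact: num_real.
move=> D CD x /=; rewrite in_itv/= => /hC/le_trans; apply; exact: ltW.
Qed.

(** This serves to ignore the mesh points, where [dx] is not controlled. Measurability of [f] is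
    inherited from [g], with which it agrees off a finite set. *)
Lemma Rintegral_finite_ext (D : set R) (s : seq R) (f g : R -> R) :
  measurable D -> measurable_fun D g ->
  (forall x, D x -> x \notin s -> f x = g x) ->
  Rintegral mu D f = Rintegral mu D g.
Proof.
move=> mD mg fg; rewrite /Rintegral; congr fine.
have mDs : measurable (D `\` [set` s]).
  by apply: measurableD => //; apply: countable_measurable => //;
    exact/finite_set_countable/finite_seq.
(* Induction on the removed points: putting one point back preserves measurability and does not
   change the integral. *)
have off (t : seq R) (h : R -> \bar R) : measurable_fun (D `\` [set` t]) h ->
    (measurable_fun D h /\ \int[mu]_(x in D `\` [set` t]) h x = \int[mu]_(x in D)
      h x)%E.
  elim: t => [|r t IH] mh.
    have e0 : [set` [::]] = set0 :> set R by apply/seteqP; split.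
    by rewrite e0 setD0 in mh *.
  have mt (t' : seq R) : measurable (D `\` [set` t']).
    by apply: measurableD => //; apply: countable_measurable => //;
      exact/finite_set_countable/finite_seq.
  have E : D `\` [set` r :: t] = (D `\` [set` t]) `\ r.
    apply/seteqP; split => x /=; rewrite in_cons.
      by move=> [Dx /negP]; rewrite negb_or => /andP[/eqP xr /negP xt].
    by move=> [[Dx xt] xr]; split => //; apply/negP; rewrite negb_or; apply/andP;
      split;
      [exact/eqP|exact/negP].
  have mh' : measurable_fun (D `\` [set` t]) h.
    have [Dr|NDr] := pselect ((D `\` [set` t]) r).
      rewrite -(@setD1K _ r (D `\` [set` t]))//; apply/measurable_funU => //.
        by rewrite -E; exact: mt.
      by split; [exact: measurable_fun_set1|rewrite -E].
    by rewrite -(not_setD1 NDr) -E.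
  have [mhD IHe] := IH mh'; split => //.
  rewrite -IHe E integral_setD1//; first by rewrite -E; exact: mt.
  by rewrite -E.
have mgs : measurable_fun (D `\` [set` s]) (EFin \o g).
  by apply/measurable_EFinP; apply: measurable_funS mg => // x [].
have mfs : measurable_fun (D `\` [set` s]) (EFin \o f).
  apply: eq_measurable_fun mgs => x; rewrite inE => -[Dx /negP sx] /=.
  by rewrite fg.
have [_ /= <-] := off _ _ mgs; have [_ /= <-] := off _ _ mfs.
by apply: eq_integral => x; rewrite inE => -[Dx /negP sx]; rewrite fg.
Qed.

End FiniteElements.

(** * The inner product *)

Section Inner.
Variables (R : realType) (G : network R) (N : edge G -> nat).
Hypothesis N_gt0 : forall e, (0 < N e)%N.
Local Notation mu := (@lebesgue_measure R).
Local Notation mesh e i := (@mesh_point R G N e i).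
Implicit Types u v w : netfun G.

Lemma eq_inner u v u' v' :
  (forall e x, 0 <= x <= len e -> u e x * v e x = u' e x * v' e x) ->
  inner u v = inner u' v'.
Proof.
move=> h; apply: eq_bigr => e _; apply: eq_Rintegral => x.
by rewrite inE/= in_itv/=; exact: h.
Qed.

(** This is how [dx] is replaced by [slope] in the variational equations. *)
Lemma inner_ae u v u' v' : bm u' -> bm v' ->
  (forall e (i : 'I_(N e)) x, mesh e i < x < mesh e i.+1 ->
    u e x * v e x = u' e x * v' e x) -> inner u v = inner u' v'.
Proof.
move=> bu bv h; apply: eq_bigr => e _.
apply: (@Rintegral_finite_ext _ _ [seq mesh e i | i <- iota 0 (N e).+1]) => //.
  by have [] := bmM bu bv e.
move=> x; rewrite [X in X -> _]/= in_itv [X in X -> _]/=.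
move=> /(in_element_ex N_gt0)[i /andP[ix xi]] xs.
have xm j : (j <= N e)%N -> x != mesh e j.
  move=> jN; apply: contra xs => /eqP ->; apply: map_f.
  by rewrite mem_iota.
apply: (h e i); rewrite !lt_neqAle ix (lteifW xi) !andbT eq_sym.
by rewrite xm ?xm// ltnW.
Qed.

Lemma innerC u v : inner u v = inner v u.
Proof. by apply: eq_inner => e x _; exact: mulrC. Qed.

Lemma innerDl u v w : bm u -> bm v -> bm w ->
  inner (fun e x => u e x + v e x) w = inner u w + inner v w.
Proof.
move=> bu bv bw; rewrite /inner -big_split/=; apply: eq_bigr => e _.
under eq_Rintegral do rewrite mulrDl.
by apply: RintegralD => //; apply: (bm_integrable _ (bmM _ _)).
Qed.

Lemma innerZl (k : R) u w : bm u -> bm w ->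
  inner (fun e x => k * u e x) w = k * inner u w.
Proof.
move=> bu bw; rewrite /inner mulr_sumr; apply: eq_bigr => e _.
under eq_Rintegral do rewrite -mulrA.
by apply: RintegralZl => //; apply: (bm_integrable _ (bmM _ _)).
Qed.

Lemma innerNl u w : bm u -> bm w ->
  inner (fun e x => - u e x) w = - inner u w.
Proof.
move=> bu bw; rewrite -mulN1r -innerZl//; apply: eq_inner => e x _.
by rewrite mulN1r.
Qed.

Lemma innerBl u v w : bm u -> bm v -> bm w ->
  inner (fun e x => u e x - v e x) w = inner u w - inner v w.
Proof.
move=> bu bv bw; rewrite -innerNl// -innerDl//.
apply: (bm_eq (bmZ (fun _ => -1) bv)) => e x; by rewrite mulN1r.
Qed.

Lemma inner_suml (J : Type) (r : seq J) (u : J -> netfun G) w :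
  (forall j, bm (u j)) -> bm w ->
  inner (fun e x => \sum_(j <- r) u j e x) w = \sum_(j <- r) inner (u j) w.
Proof.
move=> bu bw; elim: r => [|j r IH].
  rewrite big_nil -[RHS](mul0r (inner (fun _ _ => 0) w)) -innerZl//; last first.
    exact: (bm_cst (fun _ => 0)).
  by apply: eq_inner => e x _; rewrite big_nil mul0r.
rewrite big_cons -IH -innerDl//; last exact: bm_sum.
by apply: eq_inner => e x _; rewrite big_cons.
Qed.

Lemma le_inner u v u' v' : bm u -> bm v -> bm u' -> bm v' ->
  (forall e x, 0 <= x <= len e -> u e x * v e x <= u' e x * v' e x) ->
  inner u v <= inner u' v'.
Proof.
move=> bu bv bu' bv' h; apply: ler_sum => e _.
apply: le_Rintegral => //; do ?exact: (bm_integrable _ (bmM _ _)).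
by move=> x /=; rewrite in_itv/=; exact: h.
Qed.

Lemma inner_ge0 u v :
  (forall e x, 0 <= x <= len e -> 0 <= u e x * v e x) -> 0 <= inner u v.
Proof.
move=> h; apply: sumr_ge0 => e _; apply: Rintegral_ge0 => x /=.
by rewrite in_itv/=; exact: h.
Qed.

Lemma inner_cst (k : R) : inner (fun (e : edge G) _ => k) (fun _ _ => 1) =
  k * \sum_(e : edge G) len e.
Proof.
rewrite /inner mulr_sumr; apply: eq_bigr => e _.
under eq_Rintegral do rewrite mulr1.
rewrite Rintegral_cst//; congr (_ * _).
have := @lebesgue_measure_itv R `[0, len e].
by rewrite /= lte_fin len_gt0/= -EFinB subr0 => /(congr1 fine).
Qed.

Lemma norm_inner_le u v (C : R) : bm u -> bm v ->
  (forall e x, 0 <= x <= len e -> `|u e x * v e x| <= C) ->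
  `|inner u v| <= C * \sum_(e : edge G) len e.
Proof.
move=> bu bv h; rewrite -inner_cst.
have b1 (k : R) : bm (fun (_ : edge G) (_ : R) => k) by exact: (bm_cst (fun _ =>
  k)).
rewrite ler_norml; apply/andP; split.
  rewrite -innerNl//; apply: le_inner => //.
  by move=> e x /h; rewrite mulr1 ler_norml => /andP[].
apply: le_inner => // e x /h; rewrite mulr1 ler_norml => /andP[//].
Qed.

(** The parameter set over which families of integrands are uniformly bounded and Lipschitz. *)
Definition edom : set (edge G * R) := [set p | 0 <= p.2 <= len p.1].

Definition netfam (I : finType) (F : (I -> R) -> netfun G) :=
  fun z (p : edge G * R) => F z p.1 p.2.

Lemma blips_inner (I : finType) (B : set (I -> R))
    (F H : (I -> R) -> netfun G) :
  (forall z, B z -> bm (F z)) -> (forall z, B z -> bm (H z)) ->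
  blip B edom (netfam F) -> blip B edom (netfam H) ->
  blips B (fun z => inner (F z) (H z)).
Proof.
move=> bF bH fF fH; have [C [C0 hC hL]] := blipM fF fH.
pose l : R := \sum_(e : edge G) len e.
have l0 : 0 <= l by apply: sumr_ge0 => e _; exact/ltW/len_gt0.
exists (C * l); split => [|z _ Bz _|z z' _ Bz Bz' _].
- exact: mulr_ge0.
- apply: norm_inner_le; [exact: bF|exact: bH|move=> e x xe].
  exact: (hC z (e, x)).
- have b1 : bm (fun (_ : edge G) (_ : R) => 1 : R) by exact: (bm_cst (fun _ => 1)).
  have E y : inner (F y) (H y) = inner (fun e x => F y e x * H y e x) (fun _ _ =>
    1).
    by apply: eq_inner => e x _; rewrite mulr1.
  rewrite !E -innerBl//; do ?by apply: bmM; [exact: bF|exact: bH].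
  rewrite mulrAC; apply: norm_inner_le => //.
    by apply: bmB; apply: bmM; do ?[exact: bF|exact: bH].
  by move=> e x xe; rewrite mulr1; exact: (hL z z' (e, x)).
Qed.

Lemma poly_itv_eq0 (p : {poly R}) (a b : R) : a < b ->
  (forall x, a < x < b -> p.[x] = 0) -> p = 0.
Proof.
move=> ab p0.
(* A polynomial of size n with n distinct roots vanishes; [j.+1] and [n.+1] keep the equidistant
   points strictly between [a] and [b]. *)
pose n := size p; pose f (j : nat) : R := a + (b - a) * (j.+1%:R / n.+1%:R).
have n1 : 0 < n.+1%:R :> R by rewrite ltr0n.
apply: (@roots_geq_poly_eq0 _ p [seq f j | j <- iota 0 n]).
- apply/allP => _ /mapP[j + ->]; rewrite mem_iota/= add0n => jn.
  apply/rootP/p0; rewrite /f ltrDl -ltrBrDl gtr_pMr ?subr_gt0//.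
  rewrite mulr_gt0 ?subr_gt0// ?divr_gt0 ?ltr0n//=.
  by rewrite ltr_pdivrMr// mul1r ltr_nat ltnS.
- rewrite map_inj_uniq ?iota_uniq// => i j /addrI/mulfI.
  rewrite subr_eq0 gt_eqF// => /(_ isT)/mulIf.
  by rewrite invr_eq0 gt_eqF// => /(_ isT)/eqP; rewrite eqr_nat => /eqP[].
- by rewrite size_map size_iota.
Qed.

(** If the polynomial [p] of some element does not vanish at an interior point [x], the integrand is
    at least [(|p.[x]| / 2) ^+ 2] on an interval starting at [x], so the integral is positive. Hence
    every piece has a zero polynomial, and the rows of [u] are recovered from these. *)
Lemma inner_fe_eq0 k (u : fe_space N k) :
  inner (fe_fun u) (fe_fun u) = 0 -> u = 0.
Proof.
move=> u0.
suff h (e : edge G) (i : 'I_(N e)) : fe_poly u (elt i) = 0.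
  apply/row_matrixP => j; rewrite row0 -(enum_valK j).
  case: (enum_val j) => e i; have := h e i;
    rewrite /fe_poly => /(congr1 (@poly_rV _ _)).
  by move=> /(_ k.+1); rewrite rVpolyK raddf0.
have ab := mesh_lt N_gt0 e (ltnSn i).
apply: (poly_itv_eq0 ab) => x xi.
apply/eqP; rewrite -normr_le0 leNgt; apply/negP => px.
set p := fe_poly u (elt i) in px *.
have cp : p.[y] @[y --> x] --> p.[x] by exact: continuous_horner.
have /cvgrPdist_lt/(_ (`|p.[x]| / 2)) := cp; rewrite divr_gt0// => /(_ isT).
move=> [d /= d0 dp].
have [h1 h2] := andP xi.
(* The first bound keeps [y] within the continuity radius [d] of [x], the second one keeps it inside
   the element. *)
pose b := Num.min (x + d / 2) ((x + mesh e i.+1) / 2).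
have xb : x < b by rewrite /b lt_min; apply/andP; split; lra.
have bm1 : b < mesh e i.+1.
  by apply: (@le_lt_trans _ _ ((x + mesh e i.+1) / 2));
    [rewrite ge_min lexx orbT|lra].
have bd : b <= x + d / 2 by rewrite ge_min lexx.
pose c := (`|p.[x]| / 2) ^+ 2.
have c0 : 0 < c by rewrite exprn_gt0// divr_gt0.
have low y : x <= y <= b -> c <= fe_fun u e y * fe_fun u e y.
  move=> /andP[xy yb]; have iy : in_element i y.
    by apply: in_element_interior; rewrite (lt_le_trans h1 xy) (le_lt_trans yb bm1).
  rewrite (fe_fun_elt N_gt0 u iy).
  rewrite -/p -expr2 -(real_normK (num_real p.[y])) /c.
  apply: lerXn2r; rewrite ?nnegrE ?divr_ge0//.
  have yd : `|x - y| < d by rewrite distrC ger0_norm ?subr_ge0//; lra.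
  have := dp y yd; have := ler_distD p.[y] p.[x] 0; rewrite !subr0 /=; lra.
have sub y : x <= y <= b -> 0 <= y <= len e.
  move=> /andP[xy yb]; apply: (@in_element_bound _ _ _ N_gt0 e i).
  apply: in_element_interior.
  by rewrite (lt_le_trans h1 xy) (le_lt_trans yb bm1).
have : 0 < inner (fe_fun u) (fe_fun u).
  apply: (@lt_le_trans _ _ (c * (b - x))); first by rewrite mulr_gt0// subr_gt0.
  rewrite /inner (bigD1 e)//= -[leLHS]addr0 lerD//; last first.
    by apply: sumr_ge0 => e' _; apply: Rintegral_ge0 => y _; exact: sqr_ge0.
  have <- : Rintegral mu (`[0, len e] `&` `[x, b]) (fun=> c) = c * (b - x).
    rewrite setIidr; last by move=> y; rewrite /= !in_itv/=; exact: sub.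
    rewrite Rintegral_cst//; congr (_ * _).
    have := @lebesgue_measure_itv R `[x, b].
    by rewrite /= lte_fin xb -EFinB => /(congr1 fine).
  rewrite Rintegral_mkcondr; apply: le_Rintegral => //.
  - apply: measurable_bounded_integrable => //.
    + by apply: compact_finite_measure; exact: segment_compact.
    + by apply/measurable_restrict => //; exact: measurable_cst.
    + exists c; split; first exact: num_real.
      move=> M cM y _ /=; rewrite patchE; case: ifP => _.
        by rewrite ger0_norm ?ltW.
      by rewrite normr0 ltW// (lt_trans c0).
  - exact: (bm_integrable _ (bmM (bm_fe u) (bm_fe u))).
  - move=> y _; rewrite patchE; case: ifPn => [|_]; last exact: sqr_ge0.
    by rewrite inE/= in_itv/=; exact: low.
by rewrite u0 ltxx.
Qed.

End Inner.

(** * The space V_h *)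

Section SobolevSubspace.
Variable R : realType.
Local Notation mu := (@lebesgue_measure R).

Lemma L2_lin (l a : R) (u v : R -> R) : L2 l u -> L2 l v ->
  L2 l (fun x => a * u x + v x).
Proof.
move=> [mu1 iu] [mv iv].
have ml : measurable_fun (`[0, l] : set R) (fun x => a * u x + v x).
  by apply: measurable_funD => //; apply: measurable_funM.
split => //.
apply: (@le_integrable _ _ _ mu _ _ _
  (fun x => (2 * a ^+ 2 * u x ^+ 2 + 2 * v x ^+ 2)%:E)) => //.
- by apply/measurable_EFinP; exact: measurable_funX.
- move=> x _ /=; rewrite lee_fin ger0_norm ?sqr_ge0// ger0_norm; last first.
    by have := sqr_ge0 (a * u x); have := sqr_ge0 (v x); rewrite exprMn; lra.
  have := sqr_ge0 (a * u x - v x); nra.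
have h := integrableD _ (integrableZl _ (2 * a ^+ 2) iu) (integrableZl _ 2 iv).
by apply: eq_integrable (h _ _ _) => // x _; rewrite /= EFinD !EFinM.
Qed.

Lemma test_function_continuous (l : R) phi : test_function l phi ->
  continuous phi /\ continuous (derive1 phi).
Proof.
move=> [d _]; split=> x; apply: differentiable_continuous; apply/derivable1_diffP.
  exact: (d 0%N x).
exact: (d 1%N x).
Qed.

(** The weak derivatives combine linearly once the integrals split, which requires integrability of
    the products of u and v, and of their L^2 weak derivatives, with the continuous functions phi'
    and phi. *)
Lemma H1_lin (l a : R) (u v : R -> R) : H1 l u -> H1 l v ->
  H1 l (fun x => a * u x + v x).
Proof.
move=> [cu Lu [g Lg wg]] [cv Lv [k Lk wk]]; split.
- by move=> x; apply: cvgD; [apply: cvgM; [exact: cvg_cst|exact: cu]|exact: cv].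
- exact: L2_lin.
exists (fun x => a * g x + k x); first exact: L2_lin.
move=> phi tphi; have [cp cdp] := test_function_continuous tphi.
have iC (f h : R -> R) : {within `[0, l], continuous f} -> continuous h ->
    mu.-integrable `[0, l] (EFin \o (fun x => f x * h x)).
  move=> cf ch; apply: continuous_compact_integrable; first exact: segment_compact.
  have ch' : {within `[0, l], continuous h} by exact: continuous_subspaceT.
  by move=> x; apply: cvgM; [exact: cf|exact: ch'].
have iL (f h : R -> R) : L2 l f -> continuous h ->
    mu.-integrable `[0, l] (EFin \o (fun x => f x * h x)).
  move=> [mf i_f] ch.
  apply: (@le_integrable _ _ _ mu _ _ _ (fun x => (f x ^+ 2 + h x * h x)%:E)) => //.
  - apply/measurable_EFinP; apply: measurable_funM => //.
    by apply: measurable_funTS; exact: continuous_measurable_fun.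
  - move=> x _ /=; rewrite lee_fin (ger0_norm (addr_ge0 _ _)) ?sqr_ge0//.
    rewrite ler_norml; have := sqr_ge0 (f x - h x); have := sqr_ge0 (f x + h x).
    by have := sqr_ge0 (f x); have := sqr_ge0 (h x); nra.
  - have ih : mu.-integrable `[0, l] (EFin \o (fun x => h x * h x)).
      by apply: (iC h h) => //; exact: continuous_subspaceT.
    by have := integrableD _ i_f ih; apply.
have lin (f1 f2 h : R -> R) :
    mu.-integrable `[0, l] (EFin \o (fun x => f1 x * h x)) ->
    mu.-integrable `[0, l] (EFin \o (fun x => f2 x * h x)) ->
    Rintegral mu `[0, l] (fun x => (a * f1 x + f2 x) * h x) =
    a * Rintegral mu `[0, l] (fun x => f1 x * h x) +
    Rintegral mu `[0, l] (fun x => f2 x * h x).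
  move=> i1 i2; rewrite -RintegralZl// -RintegralD//.
    by apply: eq_Rintegral => x _; rewrite mulrDl mulrA.
  by apply: eq_integrable (integrableZl _ a i1) => // x _; rewrite /= EFinM.
rewrite (lin u v (derive1 phi)) ?iC// (lin g k phi) ?iL//.
by rewrite wg// wk// mulrN opprD.
Qed.

End SobolevSubspace.

Lemma Vh_lin (R : realType) (G : network R) (N : edge G -> nat) (a : R)
  (u v : fe_space N 1) : Vh u -> Vh v -> Vh (a *: u + v).
Proof.
move=> [Hu fu] [Hv fv].
have E e : fe_fun (a *: u + v) e = fun x => a * fe_fun u e x + fe_fun v e x.
  by apply/funext => x; exact: fe_fun_lin.
split=> [e|w]; first by rewrite E; exact: H1_lin.
rewrite /vertex_flux.
under eq_bigr do rewrite E.
rewrite big_split/= -mulr_sumr.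
under [X in _ - X]eq_bigr do rewrite E.
rewrite big_split/= -mulr_sumr opprD addrACA -mulrBr.
by have := fu w; have := fv w; rewrite /vertex_flux => -> ->; rewrite mulr0 addr0.
Qed.

(** Take a subspace of maximal dimension inside [P]; adjoining a further [v] satisfying [P] cannot
    raise its dimension. This supplies a basis of V_h without constructing nodal functions adapted
    to the flux conditions. *)
Lemma closed_vspace (K : fieldType) (V : vectType K) (P : V -> Prop) :
  P 0 -> (forall a u v, P u -> P v -> P (a *: u + v)) ->
  exists U : {vspace V}, forall v, v \in U <-> P v.
Proof.
move=> P0 Plin.
pose Q k := `[< exists2 U : {vspace V}, \dim U = k & forall v, v \in U -> P v >].
have exQ : exists k, Q k.
  exists 0%N; apply/asboolP; exists 0%VS; first exact: dimv0.
  by move=> v; rewrite memv0 => /eqP ->.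
have boundQ k : Q k -> (k <= \dim (fullv : {vspace V}))%N.
  by move=> /asboolP[U <- _]; apply: dimvS; exact: subvf.
case: (ex_maxnP exQ boundQ) => k /asboolP[U dU UP] kmax.
exists U => v; split=> [/UP//|Pv].
have /kmax : Q (\dim (U + <[v]>)%VS).
  apply/asboolP; exists (U + <[v]>)%VS => // w /memv_addP[u uU [w' /vlineP[c ->]
    ->]].
  by rewrite addrC; apply: Plin => //; exact: UP.
rewrite -dU => h.
have /eqP : U == (U + <[v]>)%VS by rewrite eqEdim addvSl h.
by move=> ->; apply: (subvP (addvSr _ _)); exact: memv_line.
Qed.

(** * Reduction to an ordinary differential equation *)

Section Coordinates.
Variables (R : realType) (G : network R) (a b c : edge G -> R) (gamma : R).
Variable N : edge G -> nat.
Hypothesis N_gt0 : forall e, (0 < N e)%N.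
Variable U : {vspace 'M[R]_(#|{: element N}|, 2)}.
Local Notation d := (\dim U).
Local Notation idx := (element N + 'I_d)%type.
Implicit Types (z : idx -> R) (r rd : Qh N) (m v : fe_space N 1).

Definition basis (j : 'I_d) : fe_space N 1 := (vbasis U)`_j.

(* The unknowns are the element values of rho and the coordinates of m in a
   basis of U, which stands for V_h. *)
Definition rho_of z : Qh N := \matrix_(k, l) z (inl (enum_val k)).
Definition mom_of z : fe_space N 1 := \sum_j z (inr j) *: basis j.

Definition coords r m : idx -> R := fun i =>
  match i with
  | inl K => r (enum_rank K) ord0
  | inr j => coord (vbasis U) j m
  end.

Lemma rho_of_coords r m : rho_of (coords r m) = r.
Proof. by apply/matrixP => k l; rewrite mxE /= enum_valK (ord1 l). Qed.

Lemma mom_of_coords r m : m \in U -> mom_of (coords r m) = m.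
Proof. by move=> mU; rewrite [RHS](coord_vbasis mU). Qed.

Lemma mom_of_in z : mom_of z \in U.
Proof.
apply: memv_suml => j _; apply: memvZ; apply: vbasis_mem.
by rewrite mem_nth// size_tuple ltn_ord.
Qed.

Definition inv_density r : netfun G := fun e x => (fe_fun r e x)^-1.

Definition power_density r : netfun G := fun e x =>
  c e * gamma / (gamma - 1) * fe_fun r e x `^ (gamma - 1).

(* The right-hand side of the momentum equation after the term in rho' of its
   left-hand side has been moved there and dx m replaced by the slopes:
   [flux_of] is tested against the slope of v, [source_of] against v. *)
Definition flux_of r m : netfun G := fun e x =>
  fe_fun m e x ^+ 2 * 2^-1 * inv_density r e x ^+ 2 + power_density r e x
  - a e * (inv_density r e x ^+ 2 * fe_fun (slope m) e x).

Definition source_of r m rd : netfun G := fun e x =>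
  fe_fun m e x * 2^-1 * inv_density r e x ^+ 2 * (fe_fun rd e x - fe_fun (slope
    m) e x)
  - b e * (`|fe_fun m e x| * fe_fun m e x * inv_density r e x ^+ 2).

Definition load r m rd (v : fe_space N 1) : R :=
  inner (flux_of r m) (fe_fun (slope v)) + inner (source_of r m rd) (fe_fun v).

Definition mass_form r m v : R :=
  inner (fun e x => inv_density r e x * fe_fun m e x) (fe_fun v).

Lemma bm_fe_map (g : edge G -> R -> R) r : bm (fun e x => g e (fe_fun r e x)).
Proof.
apply: (bm_eq_on (bm_fe (mapQ g r))) => e x xe.
by rewrite fe_fun_mapQ.
Qed.

Lemma bm_inv r : bm (inv_density r).
Proof. exact: (bm_fe_map (fun _ s => s^-1)). Qed.

Lemma bm_power r : bm (power_density r).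
Proof.
exact: (bm_fe_map (fun e s => c e * gamma / (gamma - 1) * s `^ (gamma - 1))).
Qed.

Lemma bm_flux r m : bm (flux_of r m).
Proof.
apply: bmB; last first.
  apply: bmZ; apply: bmM; last exact: bm_fe.
  by apply: bmM; exact: bm_inv.
apply: bmD; last exact: bm_power.
apply: bmM; last by apply: bmM; exact: bm_inv.
apply: bmM; last exact: (bm_cst (fun _ => 2^-1)).
by apply: bmM; exact: bm_fe.
Qed.

Lemma bm_source r m rd : bm (source_of r m rd).
Proof.
apply: bmB; last first.
  apply: bmZ; apply: bmM; last by apply: bmM; exact: bm_inv.
  by apply: bmM; [apply: bm_norm|]; exact: bm_fe.
apply: bmM; last by apply: bmB; exact: bm_fe.
apply: bmM; last by apply: bmM; exact: bm_inv.
by apply: bmM; [exact: bm_fe|exact: (bm_cst (fun _ => 2^-1))].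
Qed.

Lemma bm_mass r m : bm (fun e x => inv_density r e x * fe_fun m e x).
Proof. by apply: bmM; [exact: bm_inv|exact: bm_fe]. Qed.

Lemma dpotentialE (e : edge G) (s : R) : 0 < s ->
  dpotential c gamma e s = c e * gamma / (gamma - 1) * s `^ (gamma - 1).
Proof.
move=> s0; rewrite /dpotential derive1E /potential.
have h := is_deriveZ (c e / (gamma - 1)) (is_derive1_powR gamma s0).
by have [_ ->] := h; rewrite /GRing.scale/=; ring.
Qed.

(** As [slope m] is in Q_h, the sum [rd + slope m] is itself an admissible test function; it is then
    orthogonal to itself. *)
Lemma mass_equationE m rd : mass_equation m rd <-> rd = - slope m.
Proof.
have E q : inner (dx (fe_fun m)) (fe_fun q) =
    inner (fe_fun (slope m)) (fe_fun (q : Qh N)).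
  apply: (inner_ae N_gt0); [exact: bm_fe|exact: bm_fe|move=> e i x xi].
  by rewrite (dx_fe_fun N_gt0 _ xi).
split=> [h|-> q]; last first.
  rewrite E -innerNl; [|exact: bm_fe|exact: bm_fe].
  by apply: eq_inner => e x _; rewrite fe_funN.
apply/eqP; rewrite -addr_eq0; apply/eqP; apply: (inner_fe_eq0 N_gt0).
transitivity (inner (fun e x => fe_fun rd e x + fe_fun (slope m) e x)
  (fe_fun (rd + slope m))).
  by apply: eq_inner => e x _; rewrite fe_funD.
rewrite innerDl; [|exact: bm_fe|exact: bm_fe|exact: bm_fe].
by rewrite h E addrC subrr.
Qed.

Lemma momentum_equationE r m rd md : pos_density r ->
  momentum_equation a b c gamma r m rd md <->
  forall v, Vh v -> mass_form r md v = load r m rd v.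
Proof.
move=> rp; have rp' e (i : 'I_(N e)) x : mesh_point N e i < x < mesh_point N e
  i.+1 ->
    0 < fe_fun r e x.
  by move=> /in_element_interior/(in_element_bound N_gt0); exact: rp.
rewrite /momentum_equation /=.
suff E v :
  (inner (fun e x => (fe_fun r e x)^-1 * fe_fun md e x
     - fe_fun m e x / (2 * fe_fun r e x ^+ 2) * fe_fun rd e x) (fe_fun v) =
   inner (fun e x => fe_fun m e x ^+ 2 / (2 * fe_fun r e x ^+ 2)
     + dpotential c gamma e (fe_fun r e x)
     - a e / fe_fun r e x ^+ 2 * dx (fe_fun m) e x) (dx (fe_fun v))
   - inner (fun e x => fe_fun m e x / (2 * fe_fun r e x ^+ 2) * dx (fe_fun m) e x
     + b e * (`|fe_fun m e x| * fe_fun m e x / fe_fun r e x ^+ 2)) (fe_fun v)) <->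
  mass_form r md v = load r m rd v.
  by split=> h v /h /E.
(* m / (2 rho^2) multiplies both rho' and dx m. The term [s] comes from the left-hand side, [t] is
   the one subtracted on the right, and [source_of] is [s - t]. *)
pose w : netfun G := fun e x => fe_fun m e x * 2^-1 * inv_density r e x ^+ 2.
have bw : bm w.
  apply: bmM; last by apply: bmM; exact: bm_inv.
  by apply: bmM; [exact: bm_fe|exact: (bm_cst (fun _ => 2^-1))].
pose s : netfun G := fun e x => w e x * fe_fun rd e x.
pose t : netfun G := fun e x => w e x * fe_fun (slope m) e x +
  b e * (`|fe_fun m e x| * fe_fun m e x * inv_density r e x ^+ 2).
have bs : bm s by apply: bmM => //; exact: bm_fe.
have bt : bm t.
  apply: bmD; first by apply: bmM => //; exact: bm_fe.
  apply: bmZ; apply: bmM; last by apply: bmM; exact: bm_inv.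
  by apply: bmM; [apply: bm_norm|]; exact: bm_fe.
rewrite (_ : inner _ (fe_fun v) = mass_form r md v - inner s (fe_fun v));
  last first.
  rewrite -innerBl; [|exact: bm_mass|exact: bs|exact: bm_fe].
  by apply: eq_inner => e x _; rewrite /s /w /inv_density invfM exprVn !mulrA.
rewrite (_ : inner _ (dx _) = inner (flux_of r m) (fe_fun (slope v))); last first.
  apply: (inner_ae N_gt0); [exact: bm_flux|exact: bm_fe|move=> e i x xi].
  rewrite /= !(dx_fe_fun N_gt0 _ xi) dpotentialE; last exact: rp' xi.
  by rewrite /flux_of /power_density /inv_density invfM exprVn !mulrA.
rewrite [X in _ = _ - X](_ : _ = inner t (fe_fun v)); last first.
  apply: (inner_ae N_gt0); [exact: bt|exact: bm_fe|move=> e i x xi].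
  rewrite /= !(dx_fe_fun N_gt0 _ xi).
  by rewrite /t /w /inv_density invfM exprVn !mulrA.
rewrite /load (_ : inner (source_of _ _ _) _ = inner s (fe_fun v) - inner t
  (fe_fun v)).
  by split; lra.
rewrite -innerBl; [|exact: bs|exact: bt|exact: bm_fe].
by apply: eq_inner => e x _; rewrite /source_of /s /t /w; ring.
Qed.

Hypothesis UE : forall v : fe_space N 1, v \in U <-> Vh v.

Lemma inner_fe_sumr k (J : Type) (s : seq J) (y : J -> R)
    (w : J -> fe_space N k) (u : netfun G) : bm u ->
  inner u (fe_fun (\sum_(j <- s) y j *: w j)) =
  \sum_(j <- s) y j * inner u (fe_fun (w j)).
Proof.
move=> bu; rewrite innerC.
transitivity (inner (fun e x => \sum_(j <- s) y j * fe_fun (w j) e x) u).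
  apply: eq_inner => e x _; rewrite fe_fun_sum; congr (_ * _).
  by apply: eq_bigr => j _; rewrite fe_funZ.
rewrite inner_suml => // [|j]; last by apply: (bmZ (fun _ => y j)); exact: bm_fe.
apply: eq_bigr => j _; rewrite innerZl; [|exact: bm_fe|by []].
by congr (_ * _); exact: innerC.
Qed.

Lemma slope_sum (J : Type) (s : seq J) (y : J -> R) (w : J -> fe_space N 1) :
  slope (\sum_(j <- s) y j *: w j) = \sum_(j <- s) y j *: slope (w j).
Proof.
elim: s => [|j s IH]; last by rewrite !big_cons slope_lin IH.
by rewrite !big_nil; apply/matrixP => i j; rewrite !mxE.
Qed.

Lemma mass_form_suml r (y : 'I_d -> R) v :
  mass_form r (\sum_j y j *: basis j) v =
  \sum_j y j * mass_form r (basis j) v.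
Proof.
rewrite /mass_form.
transitivity (inner (fun e x => inv_density r e x * fe_fun v e x)
  (fe_fun (\sum_j y j *: basis j))).
  by apply: eq_inner => e x _; ring.
rewrite inner_fe_sumr; last exact: bm_mass.
by apply: eq_bigr => j _; congr (_ * _); apply: eq_inner => e x _; ring.
Qed.

Lemma mass_form_mom r z v :
  mass_form r (mom_of z) v = \sum_j z (inr j) * mass_form r (basis j) v.
Proof. exact: mass_form_suml. Qed.

Lemma mass_form_sumr r m (y : 'I_d -> R) :
  mass_form r m (\sum_j y j *: basis j) = \sum_j y j * mass_form r m (basis j).
Proof. by apply: inner_fe_sumr; exact: bm_mass. Qed.

Lemma load_sumr r m rd (y : 'I_d -> R) :
  load r m rd (\sum_j y j *: basis j) = \sum_j y j * load r m rd (basis j).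
Proof.
rewrite /load slope_sum !inner_fe_sumr; [|exact: bm_source|exact: bm_flux].
by rewrite -big_split/=; apply: eq_bigr => j _; rewrite mulrDr.
Qed.

Lemma fe_fun_ge r (e : edge G) x : (forall i j, 0 < r i j) -> 0 <= x <= len e ->
  0 < fe_fun r e x <= \sum_i r i ord0.
Proof.
move=> rp /(in_element_ex N_gt0)[i ix]; rewrite (fe_fun0_elt N_gt0 _ ix) rp/=.
by rewrite (bigD1 (enum_rank (elt i)))//= lerDl sumr_ge0// => j _; exact/ltW.
Qed.

(** The sum M of the element values exceeds rho everywhere, so (m, m) <= M (m / rho, m). *)
Lemma mass_form_definite r m : (forall i j, 0 < r i j) ->
  mass_form r m m = 0 -> m = 0.
Proof.
move=> rp m0; apply: (inner_fe_eq0 N_gt0); apply/eqP; rewrite eq_le.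
rewrite inner_ge0 ?andbT; last by move=> e x _; exact: sqr_ge0.
pose M := \sum_i r i ord0.
rewrite -[leRHS](mulr0 M) -m0 /mass_form -innerZl; [|exact: bm_mass|exact: bm_fe].
apply: le_inner; [exact: bm_fe|exact: bm_fe| |exact: bm_fe|].
  by apply: (bmZ (fun _ => M)); exact: bm_mass.
move=> e x xe; have /andP[r0 rM] := fe_fun_ge rp xe.
rewrite !mulrA -mulrA ler_peMl ?sqr_ge0//.
by rewrite /inv_density ler_pdivlMr// mul1r.
Qed.

Definition massmx r : 'M[R]_d := \matrix_(i, j) mass_form r (basis i) (basis j).

(** A row in the kernel is the coordinate vector of some [w] orthogonal to every basis element,
    hence to itself for the definite form; the basis being free, the row is 0. *)
Lemma massmx_unit r : (forall i j, 0 < r i j) -> massmx r \in unitmx.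
Proof.
move=> rp; rewrite -row_free_unit; apply: inj_row_free => y yM.
pose w := \sum_j y ord0 j *: basis j.
have w0 : w = 0.
  apply: (mass_form_definite rp); rewrite mass_form_sumr big1// => j _.
  have := congr1 (fun A : 'rV[R]_d => A ord0 j) yM.
  rewrite mxE [RHS]mxE => yMj; rewrite mass_form_suml.
  rewrite [X in _ * X](_ : _ = 0) ?mulr0// -[RHS]yMj.
  by apply: eq_bigr => k _; rewrite mxE.
apply/rowP => j; rewrite mxE.
have := coord_sum_free (fun j => y ord0 j) j (basis_free (vbasisP U)).
by rewrite -[X in coord _ _ X]/w w0 linear0.
Qed.

(** In the momentum part rho' is already eliminated by the mass equation, and the row of coordinates
    of m' solves [y *m massmx = load]. *)
Definition field z (i : idx) : R :=
  match i with
  | inl K => - slope (mom_of z) (enum_rank K) ord0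
  | inr j => (\row_k load (rho_of z) (mom_of z) (- slope (mom_of z)) (basis k)
                *m invmx (massmx (rho_of z))) ord0 j
  end.

(** Used in both directions: the field satisfies the variational equations, for existence and the
    energy estimate, and time derivatives satisfying them must be the field, for uniqueness. *)
Lemma field_equations z (zd : idx -> R) : (forall K, 0 < z (inl K)) ->
  (mass_equation (mom_of z) (rho_of zd) /\
   momentum_equation a b c gamma (rho_of z) (mom_of z) (rho_of zd) (mom_of zd))
  <-> zd = field z.
Proof.
move=> zp.
have rp i j : 0 < rho_of z i j by rewrite mxE.
have massE wd : mass_equation (mom_of z) (rho_of wd) <->
    forall K, wd (inl K) = field z (inl K).
  rewrite mass_equationE; split=> [h K|h].
    have := congr1 (fun A : Qh N => A (enum_rank K) ord0) h.
    by rewrite mxE enum_rankK => ->; rewrite mxE.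
  apply/matrixP => i j; rewrite (ord1 j) mxE h /field enum_valK.
  by rewrite [RHS]mxE.
have momE wd : rho_of wd = - slope (mom_of z) ->
    momentum_equation a b c gamma (rho_of z) (mom_of z) (rho_of wd) (mom_of wd) <->
    forall j, wd (inr j) = field z (inr j).
  move=> rE; rewrite momentum_equationE; last first.
    exact/(pos_densityE N_gt0).
  have Mu := massmx_unit rp.
  pose y : 'rV[R]_d := \row_j wd (inr j).
  pose l : 'rV[R]_d :=
    \row_k load (rho_of z) (mom_of z) (- slope (mom_of z)) (basis k).
  have yM j : (y *m massmx (rho_of z)) ord0 j =
      mass_form (rho_of z) (mom_of wd) (basis j).
    rewrite mxE mass_form_mom; apply: eq_bigr => i _.
    by rewrite !mxE.
  rewrite rE; split=> [h j|h v vV].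
    have -> : wd (inr j) = y ord0 j by rewrite mxE.
    rewrite /field -/l; congr (fun_of_matrix _ _ _).
    rewrite -[y](mulmxK Mu); congr (_ *m _); apply/rowP => k.
    rewrite yM mxE; apply: h; apply/UE; apply: vbasis_mem.
    by rewrite mem_nth// size_tuple ltn_ord.
  have yE : y = l *m invmx (massmx (rho_of z)).
    by apply/rowP => j; rewrite mxE h.
  rewrite (coord_vbasis (proj2 (UE v) vV)).
  rewrite mass_form_sumr load_sumr; apply: eq_bigr => j _; congr (_ * _).
  by rewrite -yM yE mulmxKV// mxE.
split=> [[/[dup] h1 /massE hK] h2|->].
  have rE := proj1 (mass_equationE _ _) h1.
  by apply/funext => -[K|j]; [exact: hK|exact: (proj1 (momE zd rE) h2)].
have h1 : mass_equation (mom_of z) (rho_of (field z)).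
  rewrite mass_equationE; apply/matrixP => i j.
  by rewrite (ord1 j) mxE /field enum_valK [RHS]mxE.
by split => //; apply/momE => //; exact/mass_equationE.
Qed.

End Coordinates.

Lemma fin_lower_bound (R : realFieldType) (J : finType) (f : J -> R) :
  (forall j, 0 < f j) -> exists2 d : R, 0 < d & forall j, d <= f j.
Proof.
move=> f0; have s0 : 0 <= \sum_j (f j)^-1 by apply: sumr_ge0 => j _;
  rewrite invr_ge0 ltW.
(* Each [(f j)^-1] is at most the sum of all; the summand 1 keeps the witness positive when [J] is
   empty. *)
exists (\sum_j (f j)^-1 + 1)^-1; first by rewrite invr_gt0 ltr_wpDl.
move=> j; rewrite -[leRHS]invrK lef_pV2 ?posrE ?invr_gt0 ?ltr_wpDl//.
rewrite (bigD1 j)//= -addrA lerDl addr_ge0// sumr_ge0// => k _.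
by rewrite invr_ge0 ltW.
Qed.

(** * Lipschitz estimates for the vector field on a box of positive densities *)

Section FieldLipschitz.
Variables (R : realType) (G : network R) (a b c : edge G -> R) (gamma : R).
Variable N : edge G -> nat.
Hypothesis N_gt0 : forall e, (0 < N e)%N.
Variable U : {vspace 'M[R]_(#|{: element N}|, 2)}.
Local Notation d := (\dim U).
Local Notation idx := (element N + 'I_d)%type.
Local Notation basis := (@basis R G N U).
Local Notation rho_of := (@rho_of R G N U).
Local Notation mom_of := (@mom_of R G N U).
Implicit Types (z : idx -> R).
Variables (lo hi : idx -> R).
Hypothesis lo_gt0 : forall K, 0 < lo (inl K).
Local Notation B := (box lo hi).
Local Notation fam F := (blip B (@edom R G) (netfam F)).

Lemma fam_cst (u : netfun G) : bm u -> fam (fun _ => u).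
Proof.
move=> /bm_bounded[C hC].
by apply: (@blip_cst _ _ _ _ _ (fun p => u p.1 p.2) C) => -[e x]; exact: hC.
Qed.

Lemma fam_lin k (J : finType) (f : J -> idx) (w : J -> fe_space N k)
    (V : (idx -> R) -> fe_space N k) :
  (forall z, V z = \sum_j z (f j) *: w j) -> fam (fun z => fe_fun (V z)).
Proof.
move=> VE.
apply: (@blip_eq _ _ _ _ _ _ (fun z p => \sum_j z (f j) * fe_fun (w j) p.1 p.2)).
  move=> z p _ _; rewrite /netfam VE fe_fun_sum.
  by apply: eq_bigr => j _; rewrite fe_funZ.
apply: blip_sum => j; apply: blipM; first exact: blip_coord.
exact: (fam_cst (bm_fe (w j))).
Qed.

Lemma fam_rho : fam (fun z => fe_fun (rho_of z)).
Proof.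
apply: (@fam_lin _ _ inl (fun K => delta_mx (enum_rank K) ord0)) => z.
apply/matrixP => i j; rewrite mxE (ord1 j) summxE (bigD1 (enum_val i))//=.
rewrite !mxE enum_valK !eqxx mulr1 big1 ?addr0// => K Ki.
by rewrite !mxE -(inj_eq enum_val_inj) enum_rankK eq_sym (negbTE Ki) mulr0.
Qed.

Lemma fam_mom : fam (fun z => fe_fun (mom_of z)).
Proof. by apply: (@fam_lin _ _ inr basis). Qed.

Lemma fam_slope : fam (fun z => fe_fun (slope (mom_of z))).
Proof.
by apply: (@fam_lin _ _ inr (fun j => slope (basis j))) => z; exact: slope_sum.
Qed.

Lemma box_density z e x : B z -> edom (e, x) ->
  exists K, fe_fun (rho_of z) e x = z (inl K).
Proof.
move=> Bz /(in_element_ex N_gt0)[i ix].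
by exists (elt i); rewrite (fe_fun0_elt N_gt0 _ ix) mxE enum_rankK.
Qed.

Lemma fam_inv : fam (fun z => inv_density (rho_of z)).
Proof.
have [dl dl0 dlo] := fin_lower_bound lo_gt0.
apply: (blipV dl0 _ fam_rho) => z [e x] Bz De.
have [K /= E] := box_density Bz De; rewrite /netfam/= E.
have /andP[h _] := Bz (inl K).
by rewrite ger0_norm ?(le_trans (dlo K))// ltW// (lt_le_trans dl0)// (le_trans
  (dlo K)).
Qed.

Lemma fam_power : fam (fun z => power_density c gamma (rho_of z)).
Proof.
have [dl dl0 dlo] := fin_lower_bound lo_gt0.
pose M := \sum_K `|hi (inl K)|.
have [C [C1 C2]] := powR_lipschitz (gamma - 1) M dl0.
have bk : fam (fun _ e x => c e * gamma / (gamma - 1)).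
  by apply: fam_cst; exact: (bm_cst (fun e => c e * gamma / (gamma - 1))).
apply: (blipM bk).
apply: (@blip_comp _ _ _ _ _ [set r | dl <= r <= M]
   (fun _ r => r `^ (gamma - 1)) C _ _ _ _ fam_rho).
- by move=> _ r _; exact: C1.
- by move=> _ r s _; exact: C2.
- move=> z [e x] Bz De; have [K /= E] := box_density Bz De; rewrite /netfam/= E.
  have /andP[h1 h2] := Bz (inl K); rewrite (le_trans (dlo K))//=.
  apply: (le_trans h2); rewrite (le_trans (ler_norm _))// /M (bigD1 K)//=.
  by rewrite lerDl sumr_ge0.
Qed.

Lemma fam_inv2 : fam (fun z e x => inv_density (rho_of z) e x ^+ 2).
Proof. by apply: (blipM fam_inv fam_inv). Qed.

Lemma fam_half : fam (fun _ _ _ => 2^-1 : R).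
Proof. by apply: fam_cst; exact: (bm_cst (fun _ => 2^-1)). Qed.

Lemma fam_flux : fam (fun z => flux_of a c gamma (rho_of z) (mom_of z)).
Proof.
apply: (blipB (blipD _ fam_power)).
  apply: (blipM _ fam_inv2); apply: (blipM _ fam_half).
  exact: (blipM fam_mom fam_mom).
apply: (blipM (fam_cst (bm_cst a))).
exact: (blipM fam_inv2 fam_slope).
Qed.

Lemma fam_source : fam (fun z =>
  source_of b (rho_of z) (mom_of z) (- slope (mom_of z))).
Proof.
apply: blipB.
  apply: blipM; first exact: (blipM (blipM fam_mom fam_half) fam_inv2).
  apply: (blipB _ fam_slope).
  apply: blip_eq (blipN fam_slope) => z p _ _; exact: fe_funN.
apply: (blipM (fam_cst (bm_cst b))).
apply: (blipM _ fam_inv2); exact: (blipM (blip_norm fam_mom) fam_mom).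
Qed.

Lemma blips_field i : blips B (fun z => field a b c gamma z i).
Proof.
have bB z : B z -> forall k l, 0 < rho_of z k l.
  by move=> Bz k l; rewrite mxE; have /andP[+ _] := Bz (inl (enum_val k));
    exact: lt_le_trans.
case: i => [K|j] /=.
  apply: blipN.
  apply: (@blip_eq _ _ _ _ _ _ (fun z _ => \sum_j z (inr j) * slope (basis j)
    (enum_rank K) ord0)).
    move=> z _ _ _; rewrite slope_sum summxE; apply: eq_bigr => j _.
    by rewrite mxE.
  apply: blip_sum => j; apply: blipM; first exact: blip_coord.
  exact: (@blip_cst _ _ _ _ _ _ `|slope (basis j) (enum_rank K) ord0|).
apply: (@blip_eq _ _ _ _ _ _ (fun z _ => \sum_k
   load a b c gamma (rho_of z) (mom_of z) (- slope (mom_of z)) (basis k) *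
   invmx (massmx U (rho_of z)) k j)).
  by move=> z _ _ _; rewrite mxE; apply: eq_bigr => k _; rewrite mxE.
apply: blip_sum => k; apply: blipM.
  apply: blipD; apply: blips_inner; do ?by move=> *; exact: bm_fe.
  - by move=> *; exact: bm_flux.
  - exact: fam_flux.
  - exact: fam_cst (bm_fe _).
  - by move=> *; exact: bm_source.
  - exact: fam_source.
  - exact: fam_cst (bm_fe _).
apply: blips_invmx => [i l|z Bz]; last exact: massmx_unit (bB z Bz).
apply: (@blip_eq _ _ _ _ _ _ (fun z _ => mass_form (rho_of z) (basis i) (basis l))).
  by move=> z _ _ _; rewrite mxE.
apply: blips_inner; do ?by move=> *; exact: bm_fe.
- by move=> *; exact: bm_mass.
- exact: (blipM fam_inv (fam_cst (bm_fe _))).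
- exact: fam_cst (bm_fe _).
Qed.

Lemma field_bounds : exists2 L : R, 0 <= L & forall i,
  (forall z, B z -> `|field a b c gamma z i| <= L) /\
  (forall z z', B z -> B z' ->
    `|field a b c gamma z i - field a b c gamma z' i| <= L * l1dist z z').
Proof.
have /choice[C hC] := blips_field.
exists (\sum_i C i) => [|i]; first by apply: sumr_ge0 => i _; have [] := hC i.
have [C0 h1 h2] := hC i.
have Cs : C i <= \sum_i C i.
  by rewrite (bigD1 i)//= lerDl sumr_ge0// => j _; have [] := hC j.
split=> [z Bz|z z' Bz Bz'].
  exact: le_trans (h1 z tt Bz _) Cs.
by apply: (le_trans (h2 z z' tt Bz Bz' _)) => //; rewrite ler_wpM2r ?l1dist_ge0.
Qed.

(* Clipping the state to the box makes the vector field globally Lipschitz. *)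
Lemma truncated_solution z0 : (forall i, lo i <= hi i) ->
  exists z : R -> idx -> R, z 0 = z0 /\ forall i (t : R), 0 <= t ->
    is_derive t 1 (z^~ i) (field a b c gamma (clip lo hi (z t)) i).
Proof.
move=> lohi; have [L L0 hL] := field_bounds.
apply: (@picard_lindelof _ _ (fun i x => field a b c gamma (clip lo hi x) i) L L)
  => //.
- move=> i x y; have [_ h] := hL i.
  apply: (le_trans (h _ _ (clip_box _ lohi) (clip_box _ lohi))).
  by rewrite ler_wpM2l ?l1dist_clip.
- by move=> i x; have [h _] := hL i; apply: h; exact: clip_box.
Qed.

End FieldLipschitz.

(** * Curves of matrices and solutions *)

Section MatrixCurves.
Variables (R : realType) (p q : nat).
Implicit Types (M : R -> 'M[R]_(p, q)).

Lemma cvg_mx (T : Type) (F : set_system T) (FF : Filter F)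
    (M : T -> 'M[R]_(p, q)) (l : 'M[R]_(p, q)) :
  (forall i j, M x i j @[x --> F] --> l i j) -> M x @[x --> F] --> l.
Proof.
move=> h; apply/cvgrPdist_le => /= e e0; near=> x.
rewrite /Num.Def.normr/= mx_normrE (bigmax_le _ (ltW e0))//= => i _.
rewrite !mxE/=; move: i; near: x; apply: filter_forall => /= i.
exact: ((cvgrPdist_le _ _).1 (h i.1 i.2)).
Unshelve. all: by end_near. Qed.

Lemma cvg_mx_coord (T : Type) (F : set_system T)
    (M : T -> 'M[R]_(p, q)) (l : 'M[R]_(p, q)) i j :
  M x @[x --> F] --> l -> M x i j @[x --> F] --> l i j.
Proof.
move=> h.
exact: (cvg_comp (fun x => M x) (fun A : 'M[R]_(p, q) =>
  A i j) h (@coord_continuous R p q i j l)).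
Qed.

(** The change of variable s = t + h links the library derivative to the difference quotients of
    [C1_on]. *)
Lemma is_derive_quotient (f : R -> R) (f' t : R) :
  is_derive t 1 f f' <-> (s - t)^-1 * (f s - f t) @[s --> t^'] --> f'.
Proof.
have shift (P : R -> Prop) : (\forall h \near 0^', P (h + t)) <->
  (\forall s \near t^', P s).
  split=> /nbhs_ballP[e /= e0 eP]; apply/nbhs_ballP; exists e => //= s.
    rewrite /ball/= => st sne; rewrite -(subrK t s); apply: eP.
      by rewrite /ball/= sub0r normrN distrC.
    by rewrite subr_eq0.
  rewrite /ball/= sub0r normrN => st sne; apply: eP.
    by rewrite /ball/= opprD addrCA subrr addr0 normrN.
  by rewrite -subr_eq0 addrK.
split=> [[df <-]|h].
  move: df; rewrite /derivable => /cvg_ex[l hl].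
  have -> : 'D_1 f t = l by apply/cvg_lim => //; exact: Rhausdorff.
  apply/cvgrPdist_lt => e e0; apply/shift.
  move/cvgrPdist_lt : hl => /(_ e e0); apply: filterS => s.
  by rewrite /GRing.scale/= mulr1 addrK.
have hl : h^-1 *: (f (h *: 1 + t) - f t) @[h --> (0 : R)^'] --> f'.
  apply/cvgrPdist_lt => e e0.
  move/cvgrPdist_lt : h => /(_ e e0)/shift; apply: filterS => s.
  by rewrite /GRing.scale/= mulr1 addrK.
split; first by apply/cvg_ex; exists f'.
by apply/cvg_lim => //; exact: Rhausdorff.
Qed.

Lemma C1_on_mx (D : set R) (M M' : R -> 'M[R]_(p, q)) :
  (forall t i j, D t -> is_derive t 1 (fun s => M s i j) (M' t i j)) ->
  (forall t i j, D t -> M' s i j @[s --> within D (nbhs t)] --> M' t i j) ->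
  C1_on D M M'.
Proof.
move=> dM cM; split=> [t Dt|].
  apply: cvg_mx => i j.
  have /is_derive_quotient h := dM t i j Dt.
  have h' : (s - t)^-1 * (M s i j - M t i j) @[s --> within D t^'] --> M' t i j.
    exact: cvg_trans (cvg_app _ (@cvg_within _ _ _ _)) h.
  by apply: cvg_trans h'; apply: near_eq_cvg; apply: nearW => s; rewrite !mxE.
by apply/subspace_continuousP => t Dt; apply: cvg_mx => i j; exact: cM.
Qed.

(** At a point with [D] as a neighbourhood, the restriction of the quotients to [D] disappears. This
    excludes time 0. *)
Lemma C1_on_is_derive (D : set R) (M M' : R -> 'M[R]_(p, q)) t i j :
  C1_on D M M' -> nbhs t D -> D t -> is_derive t 1 (fun s => M s i j) (M' t i j).
Proof.
move=> [dM _] nD Dt; apply/is_derive_quotient.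
have h := @cvg_mx_coord _ _ _ _ i j (dM t Dt).
have tD : t^' --> within D t^'.
  move=> A DA.
  have DA' : \forall x \near t^', D x -> A x by exact: DA.
  have Dn : \forall x \near t^', D x by apply: nbhs_dnbhs.
  have : \forall x \near t^', A x.
    by apply: filterS (filterI DA' Dn) => s [h' Ds]; exact: h'.
  exact.
apply: cvg_trans (cvg_trans (cvg_app _ tD) h).
by apply: near_eq_cvg; apply: nearW => s; rewrite !mxE.
Qed.

(** Near [t] the quotient is within 1 of its limit, so [M] is Lipschitz at [t] relative to [D]. This
    also covers time 0, where only one-sided quotients are available. *)
Lemma C1_on_continuous (D : set R) (M M' : R -> 'M[R]_(p, q)) t i j :
  C1_on D M M' -> D t -> M s i j @[s --> within D (nbhs t)] --> M t i j.
Proof.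
move=> [dM _] Dt; have h := @cvg_mx_coord _ _ _ _ i j (dM t Dt).
apply/cvgrPdist_lt => e e0.
pose C := `|M' t i j| + 1.
have C0 : 0 < C by rewrite ltr_wpDl.
have /cvgrPdist_lt/(_ 1 ltr01) : (s - t)^-1 * (M s i j - M t i j) @[s --> within
  D t^'] --> M' t i j.
  by apply: cvg_trans h; apply: near_eq_cvg; apply: nearW => s; rewrite !mxE.
move=> hD0.
have te : \forall s \near t, `|t - s| < e / C.
  have eC : 0 < e / C by rewrite divr_gt0.
  exact: (nbhsx_ballx t (e / C) eC).
have hD : nbhs t [set s | s != t -> D s ->
    `|M' t i j - (s - t)^-1 * (M s i j - M t i j)| < 1] by exact: hD0.
suff : nbhs t [set s | D s -> `|M t i j - M s i j| < e] by exact.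
apply: filterS (filterI hD te) => s [/= sne tse] Ds.
have [->|st] := eqVneq s t; first by rewrite subrr normr0.
have := sne st Ds; rewrite distrC => /(le_lt_trans (lerB_dist _ _)).
rewrite ltrBlDl => qC.
have -> : M t i j - M s i j = (t - s) * ((s - t)^-1 * (M s i j - M t i j)).
  by field; rewrite subr_eq0.
rewrite normrM; apply: (@le_lt_trans _ _ (`|t - s| * C));
  first by rewrite ler_wpM2l// ltW.
by rewrite -ltr_pdivlMr.
Qed.

End MatrixCurves.

(** * Correspondence between solutions of (S) and integral curves of the field *)

Section Solutions.
Variables (R : realType) (G : network R) (a b c : edge G -> R) (gamma : R).
Variable N : edge G -> nat.
Hypothesis N_gt0 : forall e, (0 < N e)%N.
Variable U : {vspace 'M[R]_(#|{: element N}|, 2)}.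
Hypothesis UE : forall v : fe_space N 1, v \in U <-> Vh v.
Local Notation d := (\dim U).
Local Notation idx := (element N + 'I_d)%type.
Local Notation basis := (@basis R G N U).
Local Notation rho_of := (@rho_of R G N U).
Local Notation mom_of := (@mom_of R G N U).
Local Notation field := (@field R G a b c gamma N U).
Local Notation coords := (@coords R G N U).

(** Eventually [z s] lies in a box around [x] whose densities are at least half those of [x], and
    there the field is Lipschitz. *)
Lemma field_cvg (T : Type) (F : set_system T) (FF : Filter F)
    (z : T -> idx -> R) (x : idx -> R) :
  (forall i, z s i @[s --> F] --> x i) -> (forall K, 0 < x (inl K)) ->
  forall i, field (z s) i @[s --> F] --> field x i.
Proof.
move=> zx x0 i.
pose lo (i : idx) := match i with inl K => x (inl K) / 2 | inr j =>
  x (inr j) - 1 end.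
pose hi (i : idx) := x i + 1.
have lo0 K : 0 < lo (inl K) by rewrite divr_gt0.
have lox k : lo k < x k by case: k => [K|j] /=; [have := x0 K|]; lra.
have [L L0 hL] := field_bounds a b c gamma N_gt0 hi lo0.
have Bx : box lo hi x by move=> k; rewrite ltW//= lerDl.
have Bz : \forall s \near F, box lo hi (z s).
  apply: filter_forall => k.
  have e0 : 0 < Num.min (x k - lo k) 1 by rewrite lt_min subr_gt0 lox ltr01.
  move/cvgrPdist_lt : (zx k) => /(_ _ e0); apply: filterS => s.
  by rewrite lt_min /hi ltr_norml ltr_norml; lra.
have dz : L * l1dist x (z s) @[s --> F] --> (0 : R).
  rewrite -(mulr0 L); apply: cvgMr.
  rewrite (_ : 0 = \sum_(i : idx) `|x i - x i|); last first.
    by rewrite big1// => k _; rewrite subrr normr0.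
  by apply: cvg_bigsum => k; apply: cvg_norm; apply: cvgB => //; exact: cvg_cst.
apply/cvgrPdist_lt => e e0.
move/cvgrPdist_lt : dz => /(_ e e0) dz.
apply: filterS (filterI Bz dz) => s [Bs]; rewrite sub0r normrN => h.
have [_ hLi] := hL i.
by apply: le_lt_trans (hLi _ _ Bx Bs) _; exact: le_lt_trans (ler_norm _) h.
Qed.

Lemma curve_solution (T : \bar R) (z : R -> idx -> R) (rho0 : Qh N) m0 :
  m0 \in U -> z 0 = coords rho0 m0 ->
  (forall t K, time_interval T t -> 0 < z t (inl K)) ->
  (forall i t, time_interval T t -> is_derive t 1 (z^~ i) (field (z t) i)) ->
  solution a b c gamma rho0 m0 T (fun t => rho_of (z t)) (fun t => mom_of (z t)).
Proof.
move=> m0U z0 zp dz.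
have zc t i : time_interval T t -> z s i @[s --> t] --> z t i.
  move=> Dt; have [+ _] := dz i t Dt.
  by move=> /derivable1_diffP/differentiable_continuous.
have fc t i : time_interval T t ->
    field (z s) i @[s --> within (time_interval T) (nbhs t)] --> field (z t) i.
  move=> Dt; apply: field_cvg => // [k|K]; last exact: zp.
  exact: cvg_trans (cvg_app _ (@cvg_within _ _ _ _)) (zc t k Dt).
split.
- move=> t Dt; split; first by apply/UE; exact: mom_of_in.
  by apply/(pos_densityE N_gt0) => i j; rewrite mxE; exact: zp.
- by rewrite z0 rho_of_coords.
- by rewrite z0 mom_of_coords.
exists (fun t => rho_of (field (z t))), (fun t => mom_of (field (z t))); split.
- apply: C1_on_mx => t i j Dt.
    under eq_fun do rewrite mxE.
    by rewrite mxE; exact: dz.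
  by under eq_fun do rewrite mxE; rewrite mxE; exact: fc.
- have E (x : idx -> R) i j : mom_of x i j = \sum_k x (inr k) * basis k i j.
    by rewrite summxE; apply: eq_bigr => k _; rewrite mxE.
  apply: C1_on_mx => t i j Dt.
    under eq_fun do rewrite E.
    rewrite E; apply: is_derive_bigsum => k.
    have h := is_derive_mulr (dz (inr k) t Dt) (is_derive_cst (basis k i j) t (1
      : R)).
    by apply: (is_derive_eq h); rewrite mulr0 addr0.
  under eq_fun do rewrite E.
  by rewrite E; apply: cvg_bigsum => k; apply: cvgM; [exact: fc|exact: cvg_cst].
- move=> t Dt; apply/(field_equations a b c gamma N_gt0 UE) => // K; exact: zp.
Qed.

Lemma time_interval_nbhs (T : \bar R) (t : R) : 0 < t -> (t%:E < T)%E ->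
  nbhs t (time_interval T).
Proof.
move=> t0 tT.
have h1 : \forall s \near t, 0 < s by exact: lt_nbhsr.
have h2 : \forall s \near t, (s%:E < T)%E.
  case: T tT => [T| |] //; last first.
    by move=> _; apply: (@nearW _ (nbhs t)) => s; rewrite ltry.
  by rewrite lte_fin => tT; near=> s; rewrite lte_fin; near: s; exact: lt_nbhsl.
by apply: filterS (filterI h1 h2) => s [/ltW s0 sT].
Unshelve. all: by end_near. Qed.

Lemma solution_curve (T : \bar R) (rho0 : Qh N) m0 rho m :
  solution a b c gamma rho0 m0 T rho m ->
  let z t := coords (rho t) (m t) in
  [/\ z 0 = coords rho0 m0,
      forall t, time_interval T t -> rho t = rho_of (z t) /\ m t = mom_of (z t),
      forall t K, time_interval T t -> 0 < z t (inl K),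
      forall t i, time_interval T t ->
        z s i @[s --> within (time_interval T) (nbhs t)] --> z t i &
      forall t i, 0 < t -> (t%:E < T)%E -> is_derive t 1 (z^~ i) (field (z t) i)].
Proof.
move=> [hV r0 h0 [rd [md [Cr Cm eqs]]]] z.
have zE t : time_interval T t -> rho t = rho_of (z t) /\ m t = mom_of (z t).
  move=> Dt; have [/UE mU _] := hV t Dt.
  by rewrite rho_of_coords mom_of_coords.
have zp t K : time_interval T t -> 0 < z t (inl K).
  by move=> Dt; have [_ /(pos_densityE N_gt0)] := hV t Dt; exact.
(* Linearity writes a coordinate as a fixed combination of matrix entries, through which limits and
   derivatives pass. *)
have coE j (A : fe_space N 1) : coord (vbasis U) j A =
    \sum_p A p.1 p.2 * coord (vbasis U) j (delta_mx p.1 p.2).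
  rewrite {1}[A]matrix_sum_delta pair_bigA linear_sum; apply: eq_bigr => p _.
  by rewrite linearZ.
split => //.
- by rewrite /z r0 h0.
- move=> t [K|j] Dt /=; first exact: (C1_on_continuous Cr Dt).
  under eq_fun do rewrite coE.
  rewrite coE; apply: cvg_bigsum => p; apply: cvgM; last exact: cvg_cst.
  exact: (C1_on_continuous Cm Dt).
move=> t i t0 tT; have nD := time_interval_nbhs t0 tT.
have Dt : time_interval T t by split => //; exact: ltW.
pose zd := coords (rd t) (md t).
have dz k : is_derive t 1 (z^~ k) (zd k).
  case: k => [K|j]; first exact: (C1_on_is_derive (enum_rank K) ord0 Cr nD Dt).
  rewrite /z/=; under eq_fun do rewrite coE.
  rewrite /zd/= coE; apply: is_derive_bigsum => p.
  have h := is_derive_mulr (C1_on_is_derive p.1 p.2 Cm nD Dt)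
    (is_derive_cst (coord (vbasis U) j (delta_mx p.1 p.2)) t (1 : R)).
  by apply: (is_derive_eq h); rewrite mulr0 addr0.
(* That m' stays in V_h is not part of [solution]; it follows by differentiating [m = mom_of z] near
   [t]. *)
have mdE : md t = mom_of zd.
  apply/matrixP => k l.
  have [_ <-] := C1_on_is_derive k l Cm nD Dt.
  rewrite summxE; under eq_bigr do rewrite mxE.
  have h : is_derive t 1 (fun s => \sum_j z s (inr j) * basis j k l)
      (\sum_j zd (inr j) * basis j k l).
    apply: is_derive_bigsum => j.
    have h := is_derive_mulr (dz (inr j)) (is_derive_cst (basis j k l) t (1 : R)).
    by apply: (is_derive_eq h); rewrite mulr0 addr0.
  have [_ <-] := h; apply: near_eq_derive.
  apply: filterS nD => s /zE[_ ->].
  by rewrite summxE; apply: eq_bigr => j _; rewrite mxE.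
have rdE : rd t = rho_of zd by rewrite rho_of_coords.
have [rE mE] := zE t Dt.
suff -> : field (z t) = zd by exact: dz.
apply/esym/(field_equations a b c gamma N_gt0 UE) => [K|]; first exact: zp.
by rewrite -rdE -mdE -rE -mE; exact: eqs.
Qed.

(** On the compact interval each coordinate attains its extrema, so both curves lie in one box whose
    density bounds are positive; there the field is Lipschitz and Gronwall applies. *)
Lemma curve_unique (z1 z2 : R -> idx -> R) (t : R) : 0 <= t ->
  (forall i, {within `[0, t], continuous z1^~ i}) ->
  (forall i, {within `[0, t], continuous z2^~ i}) ->
  (forall s K, 0 <= s <= t -> 0 < z1 s (inl K)) ->
  (forall s K, 0 <= s <= t -> 0 < z2 s (inl K)) ->
  (forall i (s : R), 0 < s < t -> is_derive s 1 (z1^~ i) (field (z1 s) i)) ->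
  (forall i (s : R), 0 < s < t -> is_derive s 1 (z2^~ i) (field (z2 s) i)) ->
  z1 0 = z2 0 -> z1 t = z2 t.
Proof.
move=> t0 c1 c2 p1 p2 d1 d2 z0.
have bounds (z : R -> idx -> R) : (forall i, {within `[0, t], continuous z^~ i}) ->
  exists l h : idx -> R, (forall i s, 0 <= s <= t -> l i <= z s i <= h i) /\
    forall i, exists2 s, 0 <= s <= t & l i = z s i.
  move=> cz.
  have /choice[l hl] : forall i, exists y, (forall s, 0 <= s <= t -> y <= z s i) /\
      exists2 s, 0 <= s <= t & y = z s i.
    move=> i; have [s st smin] := EVT_min t0 (cz i).
    by exists (z s i); split; [move=> u ut; apply: smin;
      rewrite in_itv|exists s => //; rewrite in_itv/= in st].
  have /choice[h hh] : forall i, exists y, forall s, 0 <= s <= t -> z s i <= y.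
    move=> i; have [s st smax] := EVT_max t0 (cz i).
    by exists (z s i) => u ut; apply: smax; rewrite in_itv.
  exists l, h; split=> [i s st|i]; last by have [_] := hl i.
  by have [-> // _] := hl i; rewrite hh.
have [l1 [h1 [b1 m1]]] := bounds z1 c1.
have [l2 [h2 [b2 m2]]] := bounds z2 c2.
pose lo i := Num.min (l1 i) (l2 i); pose hi i := Num.max (h1 i) (h2 i).
have lo0 K : 0 < lo (inl K).
  have [s1 s1t e1] := m1 (inl K); have [s2 s2t e2] := m2 (inl K).
  by rewrite lt_min e1 e2 p1// p2.
have [L L0 hL] := field_bounds a b c gamma N_gt0 hi lo0.
have dL i (s : R) : 0 < s < t ->
    `|field (z1 s) i - field (z2 s) i| <= L * l1dist (z1 s) (z2 s).
  move=> /andP[/ltW s0 /ltW st].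
  have s0t : 0 <= s <= t by rewrite s0 st.
  have [_ h] := hL i; apply: h => k; rewrite ge_min le_max.
    by have /andP[-> ->] := b1 k s s0t.
  by have /andP[-> ->] := b2 k s s0t; rewrite !orbT.
exact: (@gronwall_unique R _ z1 z2 (fun s => field (z1 s)) (fun s => field (z2 s))
  L t t0 c1 c2 d1 d2 dL z0).
Qed.

End Solutions.

(** * Energy dissipation *)

Lemma is_derive_invr (R : realType) (f : R -> R) (df t : R) : f t != 0 ->
  is_derive t 1 f df -> is_derive t 1 (fun s => (f s)^-1) (- df * (f t)^-1 ^+ 2).
Proof.
move=> f0 fd; apply: (is_derive_eq (is_deriveV f0 fd)).
by rewrite /GRing.scale/= exprVn mulNr mulrC -mulrN; ring.
Qed.

Section Energy.
Variables (R : realType) (G : network R) (a b c : edge G -> R) (gamma : R).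
Hypotheses (b_ge0 : forall e, 0 <= b e) (c_gt0 : forall e, 0 < c e).
Hypothesis gamma_gt1 : 1 < gamma.
Variable N : edge G -> nat.
Hypothesis N_gt0 : forall e, (0 < N e)%N.
Variable U : {vspace 'M[R]_(#|{: element N}|, 2)}.
Hypothesis UE : forall v : fe_space N 1, v \in U <-> Vh v.
Local Notation d := (\dim U).
Local Notation idx := (element N + 'I_d)%type.
Local Notation basis := (@basis R G N U).
Local Notation rho_of := (@rho_of R G N U).
Local Notation mom_of := (@mom_of R G N U).
Local Notation field := (@field R G a b c gamma N U).
Implicit Types (z zd : idx -> R) (K : element N) (q r : Qh N) (m v : fe_space N 1).

Let one : netfun G := fun _ _ => 1.

Let bm_one : bm one. Proof. exact: (bm_cst (fun _ => 1)). Qed.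

Definition ind K : netfun G := fe_fun (delta_mx (enum_rank K) ord0 : Qh N).

Lemma bm_ind K : bm (ind K). Proof. exact: bm_fe. Qed.

Lemma indE K (e : edge G) (i : 'I_(N e)) x : in_element i x ->
  ind K e x = (elt i == K)%:R.
Proof.
move=> ix; rewrite /ind (fe_fun0_elt N_gt0 _ ix) mxE eqxx andbT.
by rewrite (inj_eq enum_rank_inj).
Qed.

Lemma ind_ge0 K e x : 0 <= x <= len e -> 0 <= ind K e x.
Proof. by move=> /(in_element_ex N_gt0)[i ix]; rewrite (indE _ ix) ler0n. Qed.

(** Pulling the element values out of the integral leaves a finite sum with fixed integrals, which
    needs no differentiation under the integral sign. *)
Lemma inner_density q (u v : netfun G) : bm u -> bm v ->
  inner (fun e x => fe_fun q e x * u e x) v =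
  \sum_K q (enum_rank K) ord0 * inner (fun e x => ind K e x * u e x) v.
Proof.
move=> bu bv.
transitivity (inner (fun e x => \sum_K q (enum_rank K) ord0 * (ind K e x * u e
  x)) v).
  apply: eq_inner => e x xe; congr (_ * _).
  under eq_bigr do rewrite mulrA; rewrite -mulr_suml; congr (_ * _).
  have [i ix] := in_element_ex N_gt0 xe.
  rewrite (fe_fun0_elt N_gt0 _ ix) (bigD1 (elt i))//= (indE _ ix) eqxx mulr1.
  rewrite big1 ?addr0// => K Ki.
  by rewrite (indE _ ix) eq_sym (negbTE Ki) mulr0.
rewrite inner_suml// => [|K]; last first.
  by apply: (bmZ (fun _ => _)); apply: bmM => //; exact: bm_ind.
by apply: eq_bigr => K _; rewrite innerZl//; apply: bmM => //; exact: bm_ind.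
Qed.

Definition elt_size K : R := inner (ind K) one.

Lemma elt_size_gt0 K : 0 < elt_size K.
Proof.
have E : elt_size K = inner (ind K) (ind K).
  apply: eq_inner => e x /(in_element_ex N_gt0)[i ix].
  by rewrite (indE _ ix) /one; case: eqP; rewrite ?mulr1 ?mulr0.
rewrite lt_neqAle; apply/andP; split; last first.
  by rewrite E; apply: inner_ge0 => e x _; exact: sqr_ge0.
apply/eqP => /esym; rewrite E => /(inner_fe_eq0 N_gt0)/matrixP/(_ (enum_rank K)
  ord0).
by rewrite !mxE !eqxx => /eqP; rewrite oner_eq0.
Qed.

Definition gram K m v : R := inner (fun e x => ind K e x * fe_fun m e x) (fe_fun v).

Lemma gramC K m v : gram K m v = gram K v m.
Proof. by apply: eq_inner => e x _; ring. Qed.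

Lemma gram_sumr K m (y : 'I_d -> R) :
  gram K m (\sum_j y j *: basis j) = \sum_j y j * gram K m (basis j).
Proof. by apply: inner_fe_sumr; apply: bmM; [exact: bm_ind|exact: bm_fe]. Qed.

Lemma gram_ge0 K m : 0 <= gram K m m.
Proof.
apply: inner_ge0 => e x xe; rewrite -mulrA mulr_ge0 ?ind_ge0//.
exact: sqr_ge0.
Qed.

Lemma gram_mom K z zd : gram K (mom_of zd) (mom_of z) =
  \sum_i \sum_j zd (inr i) * z (inr j) * gram K (basis i) (basis j).
Proof.
rewrite gramC gram_sumr; apply: eq_bigr => i _.
rewrite gramC gram_sumr mulr_sumr; apply: eq_bigr => j _.
by rewrite mulrA.
Qed.

Lemma mass_form_gram r m v : mass_form r m v =
  \sum_K (r (enum_rank K) ord0)^-1 * gram K m v.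
Proof.
transitivity (inner (fun e x => fe_fun (mapQ (fun _ s =>
  s^-1) r) e x * fe_fun m e x)
  (fe_fun v)).
  by apply: eq_inner => e x xe; rewrite fe_fun_mapQ.
rewrite inner_density; [|exact: bm_fe|exact: bm_fe].
by apply: eq_bigr => K _; rewrite mxE.
Qed.

(** (m^2 / (2 rho) + P(rho), 1), written element by element so that the state enters only through
    the values of rho and the coordinates of m. *)
Definition energy z : R := \sum_K
  (2^-1 * (z (inl K))^-1 * gram K (mom_of z) (mom_of z) +
   c (tag K) / (gamma - 1) * z (inl K) `^ gamma * elt_size K).

Definition denergy z zd : R := \sum_K
  (2^-1 * (- zd (inl K) * (z (inl K))^-1 ^+ 2) * gram K (mom_of z) (mom_of z) +
   (z (inl K))^-1 * gram K (mom_of zd) (mom_of z) +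
   c (tag K) * gamma / (gamma - 1) * z (inl K) `^ (gamma - 1) * zd (inl K) *
     elt_size K).

Lemma energy_term_ge0 z K : (forall K, 0 < z (inl K)) ->
  0 <= c (tag K) / (gamma - 1) * z (inl K) `^ gamma * elt_size K.
Proof.
move=> zp; rewrite mulr_ge0 ?(ltW (elt_size_gt0 K))// mulr_ge0 ?powR_ge0//.
by rewrite divr_ge0 ?(ltW (c_gt0 _))// subr_ge0 ltW.
Qed.

Lemma energy_ge_kinetic z : (forall K, 0 < z (inl K)) ->
  \sum_K 2^-1 * (z (inl K))^-1 * gram K (mom_of z) (mom_of z) <= energy z.
Proof.
by move=> zp; apply: ler_sum => K _; rewrite lerDl energy_term_ge0.
Qed.

Lemma energy_ge0 z : (forall K, 0 < z (inl K)) -> 0 <= energy z.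
Proof.
move=> zp; apply: le_trans (energy_ge_kinetic zp); apply: sumr_ge0 => K _.
by rewrite mulr_ge0 ?gram_ge0// mulr_ge0// invr_ge0 ltW.
Qed.

Lemma is_derive_energy (z : R -> idx -> R) zd (t : R) :
  (forall K, 0 < z t (inl K)) ->
  (forall i, is_derive t 1 (z^~ i) (zd i)) ->
  is_derive t 1 (fun s => energy (z s)) (denergy (z t) zd).
Proof.
move=> zp dz; apply: is_derive_bigsum => K.
have z0 : z t (inl K) != 0 by rewrite gt_eqF.
have cst (k : R) := is_derive_cst k t (1 : R).
have dgram : is_derive t 1 (fun s => gram K (mom_of (z s)) (mom_of (z s)))
    (2 * gram K (mom_of zd) (mom_of (z t))).
  under eq_fun do rewrite gram_mom.
  have h : is_derive t 1 (fun s => \sum_i \sum_j z s (inr i) * z s (inr j) * gram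
    K (basis i) (basis j))
    (\sum_i \sum_j (zd (inr i) * z t (inr j) + z t (inr i) * zd (inr j)) * gram K
      (basis i) (basis j)).
    apply: is_derive_bigsum => i; apply: is_derive_bigsum => j.
    apply: (is_derive_eq (is_derive_mulr (is_derive_mulr (dz (inr i)) (dz (inr
      j))) (cst _))).
    by rewrite mulr0 addr0.
  apply: (is_derive_eq h).
  under eq_bigr do under eq_bigr do rewrite mulrDl.
  under eq_bigr do rewrite big_split/=.
  by rewrite big_split/= -!gram_mom (gramC K (mom_of (z t))); lra.
have dpow : is_derive t 1 (fun s => z s (inl K) `^ gamma)
    (gamma * z t (inl K) `^ (gamma - 1) * zd (inl K)).
  have h := is_derive1_comp (is_derive1_powR gamma (zp K)) (dz (inl K)).
  exact: h.
have dinv := is_derive_invr z0 (dz (inl K)).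
have h1 := is_derive_mulr (is_derive_mulr (cst 2^-1) dinv) dgram.
have h2 := is_derive_mulr (is_derive_mulr (cst (c (tag K) / (gamma - 1))) dpow)
  (cst (elt_size K)).
apply: (is_derive_eq (is_deriveD h1 h2)).
rewrite /functions.cst !mul0r !add0r mulr0 addr0.
move: (gram _ _ _) (gram _ _ _) (elt_size K) (_ `^ _) (zd _) (z t _)^-1 (gamma -
  1)^-1 => *.
by field.
Qed.

Lemma energy_cvg (T : Type) (F : set_system T) (FF : Filter F)
    (z : T -> idx -> R) x :
  (forall i, z s i @[s --> F] --> x i) -> (forall K, 0 < x (inl K)) ->
  energy (z s) @[s --> F] --> energy x.
Proof.
move=> zx x0; apply: cvg_bigsum => K.
have z0 : x (inl K) != 0 by rewrite gt_eqF.
apply: cvgD; apply: cvgM.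
- apply: cvgM; first exact: cvg_cst.
  exact: cvgV.
- under eq_fun do rewrite gram_mom.
  rewrite gram_mom; apply: cvg_bigsum => i; apply: cvg_bigsum => j.
  by apply: cvgM; [apply: cvgM|exact: cvg_cst].
- apply: cvgM; first exact: cvg_cst.
  have cp : {for x (inl K), continuous (fun s => s `^ gamma)}.
    have [+ _] := is_derive1_powR gamma (x0 K).
    by move=> /derivable1_diffP/differentiable_continuous.
  exact: (cvg_comp (fun s => z s (inl K)) _ (zx (inl K)) cp).
- exact: cvg_cst.
Qed.

Lemma inner_one (u v : netfun G) : inner u v = inner (fun e x => u e x * v e x) one.
Proof. by apply: eq_inner => e x _; rewrite /one mulr1. Qed.

(** Testing with m turns the energy derivative into the integral of a single expression, which is
    then estimated pointwise. Only the viscous dissipation on the element [K] is kept. *)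
Lemma dissipation (amin : R) z K : (forall e, amin <= a e) -> 0 < amin ->
  (forall K, 0 < z (inl K)) ->
  denergy z (field z) <= - (amin * elt_size K * (field z (inl K) / z (inl K)) ^+ 2).
Proof.
move=> aa amin0 zp.
set m := mom_of z; set r := rho_of z; set s := slope m.
have [h1 h2] := proj2 (field_equations a b c gamma N_gt0 UE (field z) zp) erefl.
have rdE : rho_of (field z) = - s := proj1 (mass_equationE N_gt0 _ _) h1.
have rp : pos_density r by apply/(pos_densityE N_gt0) => i j; rewrite mxE.
have hm : mass_form r (mom_of (field z)) m = load a b c gamma r m (- s) m.
  rewrite -rdE; apply: (proj1 (momentum_equationE a b c gamma N_gt0 _ _ _ rp) h2).
  by apply/UE; exact: mom_of_in.
(* As rho' = - s, [q1] is minus the time derivative of 1 / rho and [q2] is that of P(rho). *)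
pose q1 : Qh N := \matrix_(i, j) (- s i j * (r i j)^-1 ^+ 2).
pose q2 : Qh N := \matrix_(i, j)
  (c (tag (enum_val i)) * gamma / (gamma - 1) * r i j `^ (gamma - 1) * - s i j).
have rK L : r (enum_rank L) ord0 = z (inl L) by rewrite mxE enum_rankK.
have sK L : field z (inl L) = - s (enum_rank L) ord0 by [].
have E1 : denergy z (field z) =
    mass_form r (mom_of (field z)) m
    - 2^-1 * inner (fun e x => fe_fun q1 e x * fe_fun m e x) (fe_fun m)
    + inner (fun e x => fe_fun q2 e x * one e x) one.
  rewrite mass_form_gram !inner_density; [|exact: bm_one|exact: bm_one|exact:
    bm_fe|exact: bm_fe].
  rewrite mulr_sumr -sumrN -!big_split/=; apply: eq_bigr => L _.
  rewrite sK rK [q1 _ _]mxE [q2 _ _]mxE rK enum_rankK.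
  have -> : inner (fun e x => ind L e x * one e x) one = elt_size L.
    by apply: eq_inner => e x _; rewrite /one !mulr1.
  by rewrite /gram -/m; ring.
pose F1 : netfun G := fun e x => flux_of a c gamma r m e x * fe_fun s e x.
pose F2 : netfun G := fun e x => source_of b r m (- s) e x * fe_fun m e x.
pose F3 : netfun G := fun e x => 2^-1 * (fe_fun q1 e x * fe_fun m e x * fe_fun m
  e x).
pose F4 : netfun G := fun e x => fe_fun q2 e x.
have bF1 : bm F1 by apply: bmM; [exact: bm_flux|exact: bm_fe].
have bF2 : bm F2 by apply: bmM; [exact: bm_source|exact: bm_fe].
have bF3' : bm (fun e x => fe_fun q1 e x * fe_fun m e x * fe_fun m e x).
  by apply: bmM; [apply: bmM|]; exact: bm_fe.
have bF3 : bm F3 by apply: (bmZ (fun _ => 2^-1)).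
have bF4 : bm F4 by exact: bm_fe.
have E2 : denergy z (field z) =
    inner (fun e x => F1 e x + F2 e x - F3 e x + F4 e x) one.
  rewrite innerDl//; last by apply: bmB => //; exact: bmD.
  rewrite innerBl//; last exact: bmD.
  rewrite innerDl// E1 hm /load (inner_one (flux_of _ _ _ _ _)) (inner_one
    (source_of _ _ _ _)).
  congr (_ + _ - _ + _); last by apply: eq_inner => e x _; rewrite /one mulr1.
  by rewrite inner_one -innerZl.
rewrite E2.
pose k := amin * (field z (inl K) / z (inl K)) ^+ 2.
have -> : - (amin * elt_size K * (field z (inl K) / z (inl K)) ^+ 2) =
    inner (fun e x => - k * ind K e x) one.
  by rewrite innerZl//; [rewrite /k -/(elt_size K); ring|exact: bm_ind].
apply: le_inner => //.
- by apply: bmD => //; apply: bmB => //; exact: bmD.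
- by apply: (bmZ (fun _ => - k)); exact: bm_ind.
move=> e x xe; rewrite /one !mulr1.
have [i ix] := in_element_ex N_gt0 xe.
have Hs : fe_fun s e x = - field z (inl (elt i)) by rewrite (fe_fun0_elt N_gt0 _
  ix) sK opprK.
have Hr : fe_fun r e x = z (inl (elt i)) by rewrite (fe_fun0_elt N_gt0 _ ix) rK.
have Hq1 : fe_fun q1 e x = field z (inl (elt i)) * (z (inl (elt i)))^-1 ^+ 2.
  by rewrite (fe_fun0_elt N_gt0 _ ix) mxE rK.
have Hq2 : fe_fun q2 e x = c e * gamma / (gamma - 1) * z (inl (elt i)) `^ (gamma
  - 1) *
    field z (inl (elt i)).
  by rewrite (fe_fun0_elt N_gt0 _ ix) mxE rK enum_rankK.
rewrite /F1 /F2 /F3 /F4 Hq1 Hq2 /flux_of /source_of /power_density /inv_density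
  fe_funN Hs Hr.
rewrite (indE _ ix).
set zi := z (inl (elt i)); set f := field z (inl (elt i)); set u := fe_fun m e x.
set P := zi `^ _.
(* The convective terms occur with coefficients - 1/2, 1 and - 1/2, and the pressure flux cancels
   the derivative of P; viscosity and friction survive. *)
have -> : (u ^+ 2 * 2^-1 * zi^-1 ^+ 2 + c e * gamma / (gamma - 1) * P - a e *
  (zi^-1 ^+ 2 * - f)) * - f +
   (u * 2^-1 * zi^-1 ^+ 2 * (- - f - - f) - b e * (`|u| * u * zi^-1 ^+ 2)) * u -
   2^-1 * (f * zi^-1 ^+ 2 * u * u) + c e * gamma / (gamma - 1) * P * f =
   - (a e * (f / zi) ^+ 2) - b e * (`|u| * (u * zi^-1) ^+ 2).
  by field; rewrite subr_eq0 !gt_eqF// zp.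
have h3 : 0 <= b e * (`|u| * (u * zi^-1) ^+ 2).
  by rewrite mulr_ge0 ?b_ge0// mulr_ge0// sqr_ge0.
have h4 : amin * (f / zi) ^+ 2 <= a e * (f / zi) ^+ 2.
  by rewrite ler_wpM2r ?sqr_ge0.
have h5 : 0 <= amin * (f / zi) ^+ 2 by rewrite mulr_ge0 ?sqr_ge0// ltW.
case: eqP => [iK|_]; last by rewrite mulr0; lra.
by rewrite mulr1 /k -iK -/zi -/f; lra.
Qed.

End Energy.

(** * A priori bounds under a positive lower bound on a *)

Section APriori.
Variables (R : realType) (G : network R) (a b c : edge G -> R) (gamma : R).
Hypotheses (b_ge0 : forall e, 0 <= b e) (c_gt0 : forall e, 0 < c e).
Hypothesis gamma_gt1 : 1 < gamma.
Variable N : edge G -> nat.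
Hypothesis N_gt0 : forall e, (0 < N e)%N.
Variable U : {vspace 'M[R]_(#|{: element N}|, 2)}.
Hypothesis UE : forall v : fe_space N 1, v \in U <-> Vh v.
Local Notation d := (\dim U).
Local Notation idx := (element N + 'I_d)%type.
Local Notation basis := (@basis R G N U).
Local Notation rho_of := (@rho_of R G N U).
Local Notation mom_of := (@mom_of R G N U).
Local Notation field := (@field R G a b c gamma N U).
Local Notation energy := (@energy R G c gamma N U).
Variable amin : R.
Hypotheses (amin_gt0 : 0 < amin) (a_ge : forall e, amin <= a e).

Definition curve_on (z : R -> idx -> R) (t : R) : Prop :=
  [/\ forall i, {within `[0, t], continuous z^~ i},
      forall s K, 0 <= s <= t -> 0 < z s (inl K) &
      forall i (s : R), 0 < s < t -> is_derive s 1 (z^~ i) (field (z s) i)].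

Lemma le_of_derive_on (z : R -> idx -> R) (t : R) (f df : R -> R) :
  0 <= t -> curve_on z t ->
  (forall s : R, 0 < s < t -> is_derive s 1 f (df s)) ->
  (forall s : R, 0 < s < t -> 0 <= df s) ->
  (forall s, 0 <= s <= t ->
     f u @[u --> within `[0, t] (nbhs s)] --> f s) -> f 0 <= f t.
Proof.
move=> t0 zc fd d0 fc; apply: (le_of_derive_ge0 t0 fd d0).
by apply/subspace_continuousP => s; rewrite /= in_itv; exact: fc.
Qed.

Lemma curve_cvg z t s i : curve_on z t -> 0 <= s <= t ->
  z u i @[u --> within `[0, t] (nbhs s)] --> z s i.
Proof.
move=> [cz _ _] st; move/subspace_continuousP : (cz i); apply.
by rewrite /= in_itv.
Qed.

Lemma curve_energy_cvg z t s : curve_on z t -> 0 <= s <= t ->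
  energy (z u) @[u --> within `[0, t] (nbhs s)] --> energy (z s).
Proof.
move=> zc st; apply: energy_cvg => [i|K]; first exact: curve_cvg.
by have [_ + _] := zc; apply.
Qed.

Lemma curve_energy_derive z t s : curve_on z t -> 0 < s < t ->
  is_derive s 1 (fun u => energy (z u)) (denergy c gamma (z s) (field (z s))).
Proof.
move=> [_ zp dz] st; apply: is_derive_energy => // [K|i]; last exact: dz.
by apply: zp; lra.
Qed.

Lemma curve_ln_bound z t K : 0 <= t -> curve_on z t ->
  let C := t / 2 + energy (z 0) / (2 * (amin * elt_size K)) in
  ln (z 0 (inl K)) - C <= ln (z t (inl K)) <= ln (z 0 (inl K)) + C.
Proof.
move=> t0 zc /=; have [_ zp dz] := zc.
pose k := amin * elt_size K; have k0 : 0 < k by rewrite mulr_gt0// elt_size_gt0.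
have E0 : 0 <= energy (z t).
  by apply: energy_ge0 => // L; apply: zp; rewrite t0 lexx.
have Ek : 0 <= energy (z t) / (2 * k) by rewrite divr_ge0// mulr_ge0// ltW.
have lnD (s : R) : 0 < s < t -> is_derive s 1 (fun u => ln (z u (inl K)))
    (field (z s) (inl K) / z s (inl K)).
  move=> st; have zs : 0 < z s (inl K) by apply: zp; lra.
  have h := is_derive1_comp (is_derive1_ln zs) (dz (inl K) s st).
  by apply: (is_derive_eq h); rewrite mulrC.
(* With w = (ln rho_K)' one has [2 * `|w| <= 1 + w ^+ 2], and w ^+ 2 is
   dominated by the dissipation, so that sg * ln rho_K + t / 2 - E / (2 k) is
   nondecreasing. *)
have key (sg : R) : sg ^+ 2 = 1 ->
    sg * ln (z 0 (inl K)) - energy (z 0) / (2 * k) <=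
    sg * ln (z t (inl K)) + t / 2 - energy (z t) / (2 * k).
  move=> sg2.
  pose w (s : R) := field (z s) (inl K) / z s (inl K).
  pose f (s : R) := sg * ln (z s (inl K)) + s * 2^-1 - energy (z s) * (2 * k)^-1.
  have : f 0 <= f t.
    apply: (@le_of_derive_on z t f (fun s => sg * w s + 2^-1 -
       denergy c gamma (z s) (field (z s)) * (2 * k)^-1)) => // s st.
    - have cst (x : R) := is_derive_cst x s (1 : R).
      have h1 := is_derive_mulr (cst sg) (lnD s st).
      have h2 := is_derive_mulr (is_derive_id s (1 : R)) (cst 2^-1).
      have h3 := is_derive_mulr (curve_energy_derive zc st) (cst (2 * k)^-1).
      apply: (is_derive_eq (is_deriveB (is_deriveD h1 h2) h3)).
      by rewrite /functions.cst /w; ring.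
    - have zs L : 0 < z s (inl L) by apply: zp; lra.
      have dis := dissipation c b_ge0 gamma_gt1 N_gt0 UE K a_ge amin_gt0 zs.
      have : denergy c gamma (z s) (field (z s)) * (2 * k)^-1 <= - (w s ^+ 2 / 2).
        have k2 : 0 < 2 * k by rewrite mulr_gt0.
        rewrite ler_pdivrMr//; apply: (le_trans dis).
        by rewrite -/k -/(w s) le_eqVlt; apply/orP; left; apply/eqP; field.
      (* With [sg ^+ 2 = 1] this square says [- sg * w s <= (1 + w s ^+ 2) / 2]. *)
      have := sqr_ge0 (w s + sg); rewrite sqrrD sg2; nra.
    - have lnc : ln (z u (inl K)) @[u --> within `[0, t] (nbhs s)]
      --> ln (z s (inl K)).
        apply: (cvg_comp (fun u => z u (inl K)) _ (curve_cvg zc st)).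
        by apply: continuous_ln; exact: zp.
      apply: cvgB; [apply: cvgD|].
      + by apply: cvgM; [exact: cvg_cst|].
      + apply: cvgM; last exact: cvg_cst.
        exact: cvg_within.
      + by apply: cvgM; [exact: curve_energy_cvg|exact: cvg_cst].
  by rewrite /f mul0r addr0.
have m1 : (-1) ^+ 2 = 1 :> R by rewrite sqrrN expr1n.
rewrite -/k; have := key 1 (expr1n _ _); have := key (-1) m1.
by move: Ek; lra.
Qed.

Lemma curve_energy_le z t : 0 <= t -> curve_on z t -> energy (z t) <= energy (z 0).
Proof.
move=> t0 zc; rewrite -lerN2.
apply: (@le_of_derive_on z t (fun s => - energy (z s))
  (fun s => - denergy c gamma (z s) (field (z s)))) => // s st.
- exact: (is_deriveN (curve_energy_derive zc st)).
- have zs K : 0 < z s (inl K) by have [_ zp _] := zc; apply: zp; lra.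
  (* [dissipation] is about a given element; a network without edges has none, and its energy is an
     empty sum. *)
  rewrite oppr_ge0; case: (pickP (fun _ : element N => true)) => [K _|no].
    apply: (le_trans (dissipation c b_ge0 gamma_gt1 N_gt0 UE K a_ge amin_gt0 zs)).
    by rewrite oppr_le0 mulr_ge0 ?sqr_ge0// mulr_ge0 ?ltW// elt_size_gt0.
  by rewrite /denergy big_pred0.
- exact: (cvgN (curve_energy_cvg zc st)).
Qed.

Lemma curve_momentum_bound (M E0 : R) : exists Y : R, forall (x : idx -> R),
  (forall K, 0 < x (inl K) <= M) -> energy x <= E0 ->
  forall j, `|x (inr j)| <= Y.
Proof.
(* The coordinates are recovered from the products of m with the basis by the
   inverse Gram matrix, which is the mass matrix of the density 1. *)
pose r1 : Qh N := const_mx 1.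
have r1p i j : 0 < r1 i j by rewrite mxE ltr01.
have Mu := massmx_unit N_gt0 U r1p.
(* (m^2 / (2 rho), 1) <= E0 and rho <= M bound (m, m) by [Q], and 2 |(m, v)| <= (m, m) + (v, v) then
   bounds the product with a basis element by [S k]. *)
pose Q : R := 2 * `|M| * `|E0|.
pose S k : R := (Q + mass_form r1 (basis k) (basis k)) / 2.
exists (\sum_j \sum_k S k * `|invmx (massmx U r1) k j|) => x xp xE j.
pose y : 'rV[R]_d := \row_j x (inr j).
pose m := mom_of x.
have form1 u v : mass_form r1 u v = inner (fe_fun u) (fe_fun v).
  apply: eq_inner => e s /(in_element_ex N_gt0)[i si].
  by rewrite /inv_density (fe_fun0_elt N_gt0 _ si) mxE invr1 mul1r.
have mm : mass_form r1 m m <= Q.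
  rewrite (mass_form_gram N_gt0).
  apply: (@le_trans _ _ (\sum_K 2 * `|M| * (2^-1 * (x (inl K))^-1 * gram K m m))).
    apply: ler_sum => K _; have /andP[x0 xM] := xp K.
    rewrite mxE invr1 mul1r.
    rewrite (_ : 2 * `|M| * _ = `|M| / x (inl K) * gram K m m); last first.
      by field; rewrite gt_eqF.
    by rewrite ler_peMl ?gram_ge0// ler_pdivlMr// mul1r (le_trans xM)// ler_norm.
  rewrite -mulr_sumr /Q ler_wpM2l ?mulr_ge0//.
  have xp' K : 0 < x (inl K) by have /andP[] := xp K.
  apply: (le_trans (energy_ge_kinetic c_gt0 gamma_gt1 N_gt0 xp')).
  exact: le_trans xE (ler_norm _).
have yM k : (y *m massmx U r1) ord0 k = mass_form r1 m (basis k).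
  rewrite mxE (mass_form_mom N_gt0); apply: eq_bigr => i _.
  by rewrite !mxE.
have yS k : `|(y *m massmx U r1) ord0 k| <= S k.
  rewrite yM form1 /S form1.
  have sq (sg : R) : sg ^+ 2 = 1 ->
      0 <= inner (fe_fun m) (fe_fun m) + 2 * sg * inner (fe_fun m) (fe_fun (basis
        k))
        + inner (fe_fun (basis k)) (fe_fun (basis k)).
    move=> sg2.
    have bM u v : bm (fun e s => fe_fun (u : fe_space N 1) e s * fe_fun (v :
      fe_space N 1) e s : R).
      by apply: bmM; exact: bm_fe.
    have b1 : bm (fun (_ : edge G) (_ : R) => 1 : R) by exact: (bm_cst (fun _ =>
      1)).
    have bZ := bmZ (fun _ => 2 * sg) (bM m (basis k)).
    rewrite (inner_one (fe_fun m) (fe_fun m)) (inner_one (fe_fun m) (fe_fun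
      (basis k))).
    rewrite (inner_one (fe_fun (basis k)) (fe_fun (basis k))) -innerZl//
      -!innerDl//; last exact: bmD.
    apply: inner_ge0 => e s _; rewrite mulr1.
    have := sqr_ge0 (sg * fe_fun m e s + fe_fun (basis k) e s).
    by rewrite sqrrD exprMn sg2 mul1r; lra.
  have m1 : (-1) ^+ 2 = 1 :> R by rewrite sqrrN expr1n.
  have := sq 1 (expr1n _ _); have := sq (-1) m1.
  move: mm; rewrite form1 ler_norml.
  by move: (inner _ _) (inner _ _) (inner _ _) => p q r *; lra.
have -> : x (inr j) = y ord0 j by rewrite mxE.
rewrite -[y](mulmxK Mu) mxE (le_trans (ler_norm_sum _ _ _))//.
have S0 k : 0 <= S k by exact: le_trans (yS k).
apply: (@le_trans _ _ (\sum_k S k * `|invmx (massmx U r1) k j|)).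
  by apply: ler_sum => k _; rewrite normrM ler_wpM2r.
rewrite [leRHS](bigD1 j)//= lerDl; apply: sumr_ge0 => i _; apply: sumr_ge0 => k _.
exact: mulr_ge0.
Qed.


End APriori.

(** * Existence and uniqueness *)

(** At the infimum of the times where [P] fails it still holds by closedness, and openness carries
    it further. The openness hypothesis may use [P] on the whole of [0, t], since the a priori
    bounds require the equation to hold all along. *)
Lemma continuity_method (R : realType) (P : R -> Prop) (T : R) :
  P 0 ->
  (forall t, 0 < t <= T -> (forall s, 0 <= s < t -> P s) -> P t) ->
  (forall t : R, 0 <= t <= T -> (forall s, 0 <= s <= t -> P s) ->
     \forall s \near t, P s) ->
  forall t, 0 <= t <= T -> P t.
Proof.
move=> P0 Pcl Pop t0 t0T; apply: contrapT => nPt0.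
pose E : set R := [set t | 0 <= t <= T /\ ~ P t].
have hE : has_inf E by split; [exists t0|exists 0 => t [/andP[]]].
pose u := inf E.
have u0 : 0 <= u by apply: lb_le_inf; [exists t0|move=> t [/andP[]]].
have ut0 : u <= t0 by apply: ge_inf; [exact: hE.2|].
have uT : 0 <= u <= T by move: t0T => /andP[_ t0T]; rewrite u0 (le_trans ut0).
have Plt s : 0 <= s < u -> P s.
  move=> /andP[s0 su]; apply: contrapT => nPs.
  suff : u <= s by rewrite leNgt su.
  apply: ge_inf; first exact: hE.2.
  by split => //; rewrite s0/=; move: uT; lra.
have Ple s : 0 <= s <= u -> P s.
  move=> /andP[s0]; rewrite le_eqVlt => /predU1P[->|su]; last by apply: Plt;
    rewrite s0.
  have [->//|une] := eqVneq u 0.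
  by apply: Pcl => //; rewrite lt_neqAle eq_sym une u0; case/andP: uT.
have /nbhs_ballP[e /= e0 eP] := Pop u uT Ple.
have [s [/andP[s0 sT] nPs] su] := inf_adherent e0 hE.
have us : u <= s by apply: ge_inf; [exact: hE.2|split => //; rewrite s0].
by apply: nPs; apply: eP; rewrite /ball/= distrC ger0_norm ?subr_ge0// ltrBlDl.
Qed.

Section WellPosedness.
Variables (R : realType) (G : network R) (a b c : edge G -> R) (gamma : R).
Variable N : edge G -> nat.
Hypothesis N_gt0 : forall e, (0 < N e)%N.
Variable U : {vspace 'M[R]_(#|{: element N}|, 2)}.
Hypothesis UE : forall v : fe_space N 1, v \in U <-> Vh v.
Local Notation d := (\dim U).
Local Notation idx := (element N + 'I_d)%type.
Local Notation field := (@field R G a b c gamma N U).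
Local Notation curve_on := (@curve_on R G a b c gamma N U).

Lemma curve_uniquely_solvable (T : \bar R) (z : R -> idx -> R) (rho0 : Qh N) m0 :
  m0 \in U -> z 0 = coords rho0 m0 ->
  (forall t K, time_interval T t -> 0 < z t (inl K)) ->
  (forall i (t : R), time_interval T t -> is_derive t 1 (z^~ i) (field (z t) i)) ->
  uniquely_solvable a b c gamma rho0 m0 T.
Proof.
move=> m0U z0 zp dz.
exists (fun t => rho_of (z t)), (fun t => mom_of (z t)); split.
- exact: curve_solution.
- by move=> t Dt; apply/(pos_densityE N_gt0) => i j; rewrite mxE; exact: zp.
move=> rho2 m2 /(solution_curve N_gt0 UE)/=.
pose z2 (t : R) : idx -> R := coords (rho2 t) (m2 t).
move=> [e0 eD p2 c2 d2] t Dt.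
suff e : z2 t = z t by rewrite -e; exact: eD.
have [t0 tT] := Dt.
have sub s : 0 <= s <= t -> time_interval T s.
  by move=> /andP[s0 st]; split => //; apply: le_lt_trans tT; rewrite lee_fin.
apply: (@curve_unique _ _ a b c gamma _ N_gt0 U z2 z t) => //.
- move=> i; apply/subspace_continuousP => s; rewrite /= in_itv/= => /sub Ds.
  apply: cvg_trans (c2 s i Ds); apply: cvg_app.
  apply: within_subset => // u; rewrite /= in_itv/=; exact: sub.
- move=> i; apply: derivable_within_continuous => s; rewrite in_itv/= => /sub Ds.
  by have [] := dz i s Ds.
- by move=> s K /sub; exact: p2.
- by move=> s K /sub; exact: zp.
- move=> i s /andP[s0 st]; apply: d2 => //.
  by apply: lt_trans tT; rewrite lte_fin.
- by move=> i s /andP[/ltW s0 /ltW st]; apply: dz; apply: sub; rewrite s0.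
- by rewrite /z2 e0 z0.
Qed.

Lemma near_box (z : R -> idx -> R) (t : R) lo hi :
  (forall i, {for t, continuous (z^~ i)}) ->
  (forall i, lo i < z t i < hi i) -> \forall s \near t, box lo hi (z s).
Proof.
move=> cz zt; 
apply: (@filter_forall R idx (fun i => [set s | lo i <= z s i <= hi i]) (nbhs t))
  => i.
have /andP[l h] := zt i.
have e0 : 0 < Num.min (z t i - lo i) (hi i - z t i) by rewrite lt_min !subr_gt0 l.
move/cvgrPdist_lt : (cz i) => /(_ _ e0); apply: filterS => s.
by rewrite /= lt_min !ltr_norml; lra.
Qed.

Lemma is_derive_continuous (f : R -> R) (df t : R) : is_derive t 1 f df ->
  {for t, continuous f}.
Proof. by move=> [/derivable1_diffP/differentiable_continuous]. Qed.

Lemma local_solvability (rho0 : Qh N) m0 : m0 \in U -> (forall i j, 0 < rho0 i j) ->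
  exists2 T : R, 0 < T & uniquely_solvable a b c gamma rho0 m0 T%:E.
Proof.
move=> m0U rp; pose z0 := coords (U := U) rho0 m0.
(* A box around the initial state that keeps half of the initial density. By continuity the clipped
   solution stays in it for a short time, during which clipping has no effect. *)
pose lo (i : idx) := match i with inl K => z0 (inl K) / 2 | inr j =>
  z0 (inr j) - 1 end.
pose hi (i : idx) := z0 i + 1.
have z0p K : 0 < z0 (inl K) by exact: rp.
have lo0 K : 0 < lo (inl K) by rewrite divr_gt0.
have zi i : lo i < z0 i < hi i.
  by rewrite /hi /lo; case: i => [K|j]; [have := z0p K|]; lra.
have lohi i : lo i <= hi i by have /andP[/lt_trans h /h/ltW] := zi i.
have [z [zz0 dz]] := truncated_solution a b c gamma N_gt0 lo0 z0 lohi.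
have /nbhs_ballP[T /= T0 TP] : \forall s \near (0 : R), box lo hi (z s).
  apply: near_box => [i|i]; last by rewrite zz0.
  exact: is_derive_continuous (dz i 0 (lexx _)).
have inbox t : time_interval T%:E t -> box lo hi (z t).
  move=> [t0]; rewrite lte_fin => tT; apply: TP.
  by rewrite /ball/= sub0r normrN ger0_norm.
exists T; first exact: T0.
have zp t K : time_interval T%:E t -> 0 < z t (inl K).
  move=> Dt.
  by have /andP[+ _] := inbox t Dt (inl K); exact: lt_le_trans.
apply: (curve_uniquely_solvable m0U zz0 zp) => i t Dt.
by have := dz i t Dt.1; rewrite (clip_id (inbox t Dt)).
Qed.

Hypotheses (b_ge0 : forall e, 0 <= b e) (c_gt0 : forall e, 0 < c e).
Hypothesis gamma_gt1 : 1 < gamma.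
Variable amin : R.
Hypotheses (amin_gt0 : 0 < amin) (a_ge : forall e, amin <= a e).

(** The bounds are uniform over all curves and all times up to [T], so the box can be fixed before
    the clipped equation is solved. *)
Lemma a_priori_bounds (z0 : idx -> R) (T : R) : (forall K, 0 < z0 (inl K)) ->
  exists dl M Y : R, 0 < dl /\ forall z t, 0 <= t <= T -> z 0 = z0 ->
    curve_on z t ->
    (forall K, dl <= z t (inl K) <= M) /\ forall j, `|z t (inr j)| <= Y.
Proof.
move=> z0p; pose E0 := energy c gamma z0.
pose C (K : element N) := T / 2 + E0 / (2 * (amin * elt_size K)).
have [dl dl0 hdl] := fin_lower_bound (fun K => expR_gt0 (ln (z0 (inl K)) - C K)).
pose M := \sum_K expR (ln (z0 (inl K)) + C K).
have [Y hY] := curve_momentum_bound c_gt0 gamma_gt1 N_gt0 U M E0.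
exists dl, M, Y; split => // z t /andP[t0 tT] zz0 zc.
have [_ zp _] := zc.
have zp' K : 0 < z t (inl K) by apply: zp; rewrite t0 lexx.
have bd K : dl <= z t (inl K) <= M.
  have /= := curve_ln_bound b_ge0 c_gt0 gamma_gt1 N_gt0 UE amin_gt0 a_ge K t0 zc.
  rewrite zz0 -/E0 => /andP[h1 h2].
  have zE : z t (inl K) = expR (ln (z t (inl K))) by rewrite lnK ?posrE.
  apply/andP; split.
    apply: (le_trans (hdl K)); rewrite zE ler_expR.
    by apply: le_trans h1; rewrite /C; lra.
  apply: (@le_trans _ _ (expR (ln (z0 (inl K)) + C K))).
    by rewrite zE ler_expR (le_trans h2)// /C; lra.
  by rewrite /M (bigD1 K)//= lerDl sumr_ge0// => L _; exact: expR_ge0.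
split => //; apply: hY => [K|].
  by rewrite zp'/=; have /andP[] := bd K.
by rewrite /E0 -zz0; apply: (curve_energy_le b_ge0 gamma_gt1 N_gt0 UE amin_gt0
  a_ge).
Qed.

Lemma solution_up_to (z0 : idx -> R) (T : R) :
  (forall K, 0 < z0 (inl K)) -> 0 <= T ->
  exists z : R -> idx -> R, [/\ z 0 = z0,
    forall t K, 0 <= t <= T -> 0 < z t (inl K) &
    forall i (t : R), 0 <= t <= T -> is_derive t 1 (z^~ i) (field (z t) i)].
Proof.
move=> z0p T0; have [dl [M [Y [dl0 bounds]]]] := a_priori_bounds T z0p.
(* The box exceeds the a priori bounds by a margin on every side, so a curve obeying them is in its
   interior. *)
pose lo (i : idx) := match i with inl K => dl / 2 | inr j => - Y - 1 end.
pose hi (i : idx) := match i with inl K => M + 1 | inr j => Y + 1 end.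
have lo0 K : 0 < lo (inl K) by rewrite divr_gt0.
have inner_box (z : R -> idx -> R) t : 0 <= t <= T -> z 0 = z0 -> curve_on z t ->
    forall i, lo i < z t i < hi i.
  move=> tT e zc; have [h1 h2] := bounds z t tT e zc.
  case=> [K|j] /=; first by have := h1 K; lra.
  by have := h2 j; rewrite ler_norml; lra.
(* On the degenerate interval [0, 0] a constant is a curve, so the a priori bounds apply to the
   initial state itself. *)
have c0 : curve_on (fun _ => z0) 0.
  split=> [i|s K _|i s]; [|exact: z0p|lra].
  by move=> x; exact: cvg_cst.
have z0in i : lo i < z0 i < hi i.
  by apply: (inner_box (fun _ => z0) 0 _ erefl c0); rewrite lexx.
have lohi i : lo i <= hi i by have /andP[/lt_trans h /h/ltW] := z0in i.
have [z [zz0 dz]] := truncated_solution a b c gamma N_gt0 lo0 z0 lohi.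
have zct i (t : R) : 0 <= t -> {for t, continuous (z^~ i)}.
  by move=> t0; exact: is_derive_continuous (dz i t t0).
have curve t : 0 <= t -> (forall s, 0 <= s <= t -> box lo hi (z s)) -> curve_on z t.
  move=> t0 zb; split.
  - move=> i; apply: derivable_within_continuous => s;
    rewrite in_itv/= => /andP[s0 _].
    by have [] := dz i s s0.
  - by move=> s K /zb/(_ (inl K))/andP[+ _]; exact: lt_le_trans.
  - move=> i s /andP[/ltW s0 /ltW st]; have := dz i s s0.
    by rewrite clip_id//; apply: zb; rewrite s0.
have inbox : forall t, 0 <= t <= T -> box lo hi (z t).
  apply: continuity_method.
  - move=> i; rewrite zz0; have /andP[h1 h2] := z0in i.
    by rewrite !ltW.
  - move=> t /andP[t0 tT] zs i.
    have cl : z s i @[s --> t^'-] --> z t i.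
      by apply: cvg_at_left_filter; exact: zct (ltW t0).
    have sn : \forall s \near t^'-, box lo hi (z s).
      near=> s; apply: zs; apply/andP; split; near: s; [|exact: nbhs_left_lt].
      exact: nbhs_left_ge.
    apply/andP; split.
      apply: (cvgr_to_ge cl); near=> s.
      have : box lo hi (z s) by near: s.
      by move=> /(_ i)/andP[].
    apply: (cvgr_to_le cl); near=> s.
    have : box lo hi (z s) by near: s.
    by move=> /(_ i)/andP[].
  - move=> t tT zb; have t0 : 0 <= t by case/andP: tT.
    apply: near_box => [i|]; first exact: zct.
    exact: inner_box (curve t t0 zb).
exists z; split => //.
- by move=> t K /inbox/(_ (inl K))/andP[+ _]; exact: lt_le_trans.
- move=> i t tT; have := dz i t; rewrite clip_id; last exact: inbox.
  by apply; case/andP: tT.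
Unshelve. all: by end_near. Qed.

Lemma global_solvability (rho0 : Qh N) m0 :
  m0 \in U -> (forall i j, 0 < rho0 i j) ->
  uniquely_solvable a b c gamma rho0 m0 +oo%E.
Proof.
move=> m0U rp; pose z0 := coords (U := U) rho0 m0.
have z0p K : 0 < z0 (inl K) by exact: rp.
have /choice[Z ZP] := fun n : nat => @solution_up_to z0 n.+1%:R z0p (ler0n _ _).
have Zeq n k t : 0 <= t -> t <= n.+1%:R -> t <= k.+1%:R -> Z n t = Z k t.
  move=> t0 tn tk.
  have [en pn dn] := ZP n; have [ek pk dk] := ZP k.
  have sub (l : nat) (s : R) : t <= l.+1%:R -> 0 <= s <= t ->
    0 <= s <= l.+1%:R by lra.
  apply: (@curve_unique _ _ a b c gamma _ N_gt0 U (Z n) (Z k) t) => //.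
  - move=> i; apply: derivable_within_continuous => s;
    rewrite in_itv/= => /(sub n s tn) Ds.
    by have [] := dn i s Ds.
  - move=> i; apply: derivable_within_continuous => s;
    rewrite in_itv/= => /(sub k s tk) Ds.
    by have [] := dk i s Ds.
  - by move=> s K /(sub n s tn); exact: pn.
  - by move=> s K /(sub k s tk); exact: pk.
  - by move=> i s st; apply: dn; apply: (sub n s tn); lra.
  - by move=> i s st; apply: dk; apply: (sub k s tk); lra.
  - by rewrite en ek.
(* The solutions on [0, n + 1] agree by uniqueness, so they can be glued. *)
pose z (t : R) := Z (Num.truncn t) t.
have trn (t : R) : 0 <= t -> 0 <= t <= (Num.truncn t).+1%:R.
  by move=> t0; rewrite t0/= ltW// truncnS_gt.
apply: (@curve_uniquely_solvable _ z) => //.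
- by rewrite /z; have [] := ZP (Num.truncn (0 : R)).
- by move=> t K [t0 _]; have [_ + _] := ZP (Num.truncn t); apply; exact: trn.
move=> i t [t0 _]; pose n := Num.truncn t.
have [_ _ /(_ i t (trn t t0)) dZ] := ZP n.
have nz : \forall s \near t, Z n s i = z s i.
  have tn : t < n.+1%:R by rewrite truncnS_gt.
  have sn : \forall s \near t, s < n.+1%:R by exact: lt_nbhsl.
  (* At time 0 the neighbourhood contains negative times, where uniqueness says nothing; but
     [truncn] is 0 there, so [z] is [Z 0] by definition. *)
  have [t00|tne] := eqVneq t 0.
    have sm : \forall s \near t, s < 1 by rewrite t00; exact: lt_nbhsl.
    apply: filterS sm => s s1; rewrite /z; congr (Z _ s i).
    have -> : n = 0%N by rewrite /n t00 truncn0.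
    by apply/esym/truncn0Pn; rewrite -ltNge.
  have sp : \forall s \near t, 0 < s by apply: lt_nbhsr;
    rewrite lt_neqAle eq_sym tne.
  apply: filterS (filterI sn sp) => s [/ltW sn' /ltW s0].
  by rewrite /z (Zeq n (Num.truncn s) s)//; have /andP[] := trn s s0.
exact: near_eq_is_derive nz dZ.
Qed.

End WellPosedness.

Theorem lemma4p4 (R : realType) (G : network R)
    (a b c : edge G -> R) (gamma : R)
    (a_ge0 : forall e, 0 <= a e) (b_ge0 : forall e, 0 <= b e)
    (c_gt0 : forall e, 0 < c e) (gamma_gt1 : 1 < gamma)
    (N : edge G -> nat) (N_gt0 : forall e, (0 < N e)%N)
    (rho0 : Qh N) (m0 : fe_space N 1) (m0_Vh : Vh m0)
    (rhomin : R) (rhomin_gt0 : 0 < rhomin)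
    (rho0_ge : forall (e : edge G) (x : R),
       0 <= x <= len e -> rhomin <= fe_fun rho0 e x) :
  (exists2 T : R, 0 < T & uniquely_solvable a b c gamma rho0 m0 T%:E) /\
  ((exists2 amin : R, 0 < amin & forall e, amin <= a e) ->
   uniquely_solvable a b c gamma rho0 m0 +oo%E).
Proof.
(* Writing 0 as - m0 + m0 deduces this from linearity instead of checking membership in H^1. *)
have Vh0 : Vh (0 : fe_space N 1).
  by rewrite -(addNr m0) -scaleN1r; exact: Vh_lin.
have [U UE] := closed_vspace Vh0 (@Vh_lin _ _ N).
have m0U : m0 \in U by exact/UE.
have rho0_gt0 : forall i j, 0 < rho0 i j.
  by apply/(pos_densityE N_gt0) => e x /rho0_ge; exact: lt_le_trans.
split; first exact: (local_solvability a b c gamma N_gt0 UE m0U rho0_gt0).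
move=> [amin amin_gt0 a_ge].
exact: (global_solvability N_gt0 UE b_ge0 c_gt0 gamma_gt1 amin_gt0 a_ge m0U
  rho0_gt0).
Qed.
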